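(* Let $k,l,m$ be ranks of set partitions of $\underline{n}$ (so $0\le k,l,m\leq n$), and let $\lambda\vdash k$, $\mu\vdash l$, $\nu\vdash m$. Then the multiplicity of the simple $\Bbbk[I_n^*]$-module $\mathbf{N}^{\nu}$ in $\mathbf{N}^{\lambda}\otimes_\Bbbk\mathbf{N}^{\mu}$ equals $$\sum_{M}\left[\mathrm{Ind}^{S_m}_{H_M}\mathrm{Res}^{S_k\times S_l}_{H_M}\big(\mathbf{S}^\lambda\otimes_\Bbbk\mathbf{S}^\mu\big):\mathbf{S}^\nu\right],$$ where $M$ runs over a set of representatives of the $(S_k\times S_l)$-orbits on $Q_{k,l}^m$, and $H_M$ is the stabilizer of $M$ in $S_k\times S_l$, also regarded as a subgroup of $S_m$ via its permutation action on the $m$ entries of $M$ equal to $1$.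
   Context: $\Bbbk$ is an algebraically closed field of characteristic zero; $\underline{n}=\{1,\dots,n\}$; $\mathbf{S}^\lambda$ denotes the Specht module of a symmetric group; $[V:\mathbf{S}^\nu]$ denotes the multiplicity of $\mathbf{S}^\nu$ in $V$. The rank of a set partition is its number of parts. Dual symmetric inverse semigroup $I_n^*$: an element $\xi$ consists of two set partitions $\mathrm{dom}(\xi)$, $\mathrm{cod}(\xi)$ of $\underline{n}$ with the same number of parts and a bijection $\overline{\xi}$ from the parts of $\mathrm{dom}(\xi)$ to the parts of $\mathrm{cod}(\xi)$. The product $\xi\zeta$ (right to left) is: let $\omega$ be the finest set partition of $\underline{n}$ coarser than both $\mathrm{cod}(\zeta)$ and $\mathrm{dom}(\xi)$; for each part $B$ of $\omega$, $\xi\zeta$ has a domain part equal to the union of all $\overline{\zeta}^{-1}(C)$, with $C\subseteq B$ a part of $\mathrm{cod}(\zeta)$, mapped to the codomain part equal to the union of all $\overline{\xi}(D)$, with $D\subseteq B$ a part of $\mathrm{dom}(\xi)$. For a set partition $\rho$ of $\underline{n}$, $\mathbf{L}_\rho=\{\xi\in I_n^*:\mathrm{dom}(\xi)=\rho\}$, and $S_\rho=\{\xi:\mathrm{dom}(\xi)=\mathrm{cod}(\xi)=\rho\}$ is the symmetric group on the parts of $\rho$. The cell module $\Bbbk[\mathbf{L}_\rho]$ has basis $\mathbf{L}_\rho$ with $\xi\cdot\zeta=\xi\zeta$ if $\xi\zeta\in\mathbf{L}_\rho$ and $\xi\cdot\zeta=0$ otherwise; $S_\rho$ acts on it by right multiplication.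 For a set partition $\rho$ with $k$ parts and $\lambda\vdash k$, $\mathbf{N}^\lambda:=\Bbbk[\mathbf{L}_\rho]\otimes_{\Bbbk[S_\rho]}\mathbf{S}^\lambda$ (with $S_\rho\cong S_k$); it is simple and, up to isomorphism, depends only on $\lambda$; all simple $\Bbbk[I_n^*]$-modules are of this form, and $\Bbbk[I_n^*]$ is semisimple. Tensor products of $\Bbbk[I_n^*]$-modules carry the diagonal action of $I_n^*$. $Q_{k,l}^{m}$ is the set of all $k\times l$ matrices with $0/1$-entries with exactly $m$ entries equal to $1$, all rows non-zero and all columns non-zero. $S_k\times S_l$ acts on it by independent permutations of rows and columns. Each element of the stabilizer $H_M$ of $M$ permutes the $m$ entries of $M$ equal to $1$; after fixing a bijection between these entries and $\underline{m}$ this gives an injective homomorphism $H_M\to S_m$. *)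

(* Defs.v *)
(* MathComp; the classical layer of MathComp-Analysis provides [boolp.asbool]
   and [classical_sets.xget]. *)
From HB Require Import structures.
From mathcomp Require Import all_boot all_order all_algebra all_fingroup.
From mathcomp Require Import mxtens.
From mathcomp Require boolp classical_sets.

Set Implicit Arguments.
Unset Strict Implicit.
Unset Printing Implicit Defensive.

Import GRing.Theory VectorInternalTheory.
Local Open Scope ring_scope.

(* MathComp multiplies permutations from left to right: [(s * t) i = t (s i)].
   The opposite product [x * y := y * x] turns it into composition of maps, so
   that left modules over [opgroup 'S_k] are left modules over the symmetric
   group with the same right-to-left convention as I_n^* below. *)
Definition opgroup (gT : Type) : Type := gT.

Section OpGroup.
Variable gT : finGroupType.
Definition op_mul (x y : gT) : gT := (y * x)%g.
Fact op_mulA : associative op_mul.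
Proof. by move=> x y z; rewrite /op_mul mulgA. Qed.
Fact op_mul1g : left_id (1%g : gT) op_mul.
Proof. by move=> x; rewrite /op_mul mulg1. Qed.
Fact op_mulg1 : right_id (1%g : gT) op_mul.
Proof. by move=> x; rewrite /op_mul mul1g. Qed.
HB.instance Definition _ := Finite.copy (opgroup gT) gT.
HB.instance Definition _ := isMonoid.Build (opgroup gT) op_mulA op_mul1g op_mulg1.
End OpGroup.

Section Modules.
Variable F : fieldType.

Record rep (A : monoidType) := Rep {
  rep_sort :> vectType F;
  act : A -> 'End(rep_sort);
  act_one : act 1%g = \1%VF;
  act_mul : forall x y, act (x * y)%g = (act x \o act y)%VF }.

Definition group_rep (gT : finGroupType) := rep (opgroup gT).

Definition GroupRep (gT : finGroupType) (V : vectType F) (a : gT -> 'End(V))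
    (a1 : a 1%g = \1%VF) (aM : forall x y, a (x * y)%g = (a y \o a x)%VF) :
  group_rep gT := @Rep (opgroup gT) V a a1 (fun x y => aM y x).

Section Multiplicity.
Variable A : monoidType.
Implicit Types V L : rep A.

Definition stable V (U : {vspace V}) : Prop :=
  forall x : A, (act V x @: U <= U)%VS.

Definition simple_step V (W U : {vspace V}) : Prop :=
  [/\ stable W, stable U, (W <= U)%VS /\ W != U
    & forall X : {vspace V}, stable X -> (W <= X)%VS -> (X <= U)%VS ->
        X = W \/ X = U].

(* U / W is isomorphic to L, through a linear map f whose restriction to U is
   equivariant, onto, and of kernel W. *)
Definition factor_iso V L (W U : {vspace V}) : Prop :=
  exists f : 'Hom(V, L),
    [/\ (f @: U)%VS = fullv, (U :&: lker f)%VS = W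
      & forall (x : A) u, u \in U -> f (act V x u) = act L x (f u)].

Definition mult_spec V L (r : nat) : Prop :=
  exists (t : nat) (U : nat -> {vspace V}),
    [/\ U 0%N = 0%VS, U t = fullv,
        forall i, (i < t)%N -> simple_step (U i) (U i.+1)
      & r = #|[set i : 'I_t | boolp.asbool (factor_iso L (U i) (U i.+1))]|].

(* [V : L]: the number of factors isomorphic to L in a composition series of V
   (by Jordan-Hoelder, exactly one r satisfies [mult_spec V L r]). *)
Definition mult V L : nat := classical_sets.xget 0%N (mult_spec V L).

End Multiplicity.

Section SubQuotient.
Variables (A : monoidType) (V : rep A) (U : {vspace V}).
Hypothesis stU : stable U.

Fact stable_act x u : u \in U -> act V x u \in U.
Proof. by move=> Uu; apply: (subvP (stU x)); apply: memv_img. Qed.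

Definition sub_act (x : A) : 'End(subvs_of U) :=
  linfun (vsproj U \o act V x \o vsval).

Fact sub_actE x u : vsval (sub_act x u) = act V x (vsval u).
Proof. by rewrite lfunE /= vsprojK // stable_act // subvsP. Qed.

Fact sub_act1 : sub_act 1%g = \1%VF.
Proof.
by apply/lfunP=> u; apply: subvs_inj; rewrite sub_actE act_one !lfunE.
Qed.

Fact sub_actM x y : sub_act (x * y)%g = (sub_act x \o sub_act y)%VF.
Proof.
apply/lfunP=> u; apply: subvs_inj.
by rewrite sub_actE act_mul !comp_lfunE !sub_actE.
Qed.

Definition sub_rep : rep A := Rep sub_act1 sub_actM.

(* The quotient V / U is carried by the complement U^C: [quot_proj] is the
   projection of V onto U^C along U. *)
Definition quot_proj : 'Hom(V, subvs_of (U^C)%VS) :=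
  linfun (vsproj (U^C)%VS \o daddv_pi (U^C)%VS U).

Lemma quot_projK v : v - vsval (quot_proj v) \in U.
Proof.
have dUC : (U^C :&: U = 0)%VS by rewrite capvC capv_compl.
have vT : v \in (U^C + U)%VS by rewrite addvC addv_complf memvf.
rewrite lfunE /= vsprojK ?memv_pi // -{1}(daddv_pi_add dUC vT).
by rewrite addrC addKr memv_pi.
Qed.

Lemma quot_proj_id w : quot_proj (vsval w) = w.
Proof.
have dUC : (U^C :&: U = 0)%VS by rewrite capvC capv_compl.
by rewrite lfunE /= daddv_pi_id ?subvsP // vsvalK.
Qed.

Lemma quot_proj0 v : (quot_proj v == 0) = (v \in U).
Proof.
apply/eqP/idP=> [pv0 | Uv].
  by have := quot_projK v; rewrite pv0 linear0 addr0.
apply: subvs_inj; apply/eqP; rewrite raddf0 -memv0 -(capv_compl U) memv_cap.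
by rewrite subvsP andbT -[vsval _](subKr v) rpredB ?quot_projK.
Qed.

Definition quot_act (x : A) : 'End(subvs_of (U^C)%VS) :=
  linfun (quot_proj \o act V x \o vsval).

Lemma quot_actE x v : quot_act x (quot_proj v) = quot_proj (act V x v).
Proof.
rewrite lfunE /=; apply/eqP; rewrite -subr_eq0 -!linearB quot_proj0.
by rewrite -[_ - v]opprB linearN rpredN stable_act ?quot_projK.
Qed.

Fact quot_act1 : quot_act 1%g = \1%VF.
Proof. by apply/lfunP=> w; rewrite lfunE /= act_one !id_lfunE quot_proj_id. Qed.

Fact quot_actM x y : quot_act (x * y)%g = (quot_act x \o quot_act y)%VF.
Proof.
apply/lfunP=> w; rewrite -(quot_proj_id w) comp_lfunE !quot_actE.
by rewrite act_mul comp_lfunE.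
Qed.

Definition quot_rep : rep A := Rep quot_act1 quot_actM.

End SubQuotient.

(* U (x) V through the coordinates of [vectType] and the Kronecker product. *)
Section Tensor.
Variables U V : vectType F.

Definition tensV : vectType F := 'rV[F]_(dim U * dim V).
Definition pure_tens (u : U) (v : V) : tensV := v2r u *t v2r v.
Definition tens_lfun (f : 'End(U)) (g : 'End(V)) : 'End(tensV) :=
  linfun (mulmxr (f2mx f *t f2mx g)).

Lemma v2r_lfun (W W' : vectType F) (f : 'Hom(W, W')) u :
  v2r (f u) = v2r u *m f2mx f.
Proof. by rewrite unlock /= r2vK. Qed.

Lemma tens_lfunE f g u v :
  tens_lfun f g (pure_tens u v) = pure_tens (f u) (g v).
Proof.
rewrite lfunE /= /pure_tens !v2r_lfun.
exact: (@tensmx_mul F 1 _ 1 _ _ _ (v2r u) (v2r v) (f2mx f) (f2mx g)).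
Qed.

Lemma f2mx_comp (W : vectType F) (f g : 'End(W)) :
  f2mx (f \o g)%VF = f2mx g *m f2mx f.
Proof.
apply/row_matrixP=> i; rewrite !rowE -[delta_mx 0 i]r2vK -v2r_lfun comp_lfunE.
by rewrite !v2r_lfun mulmxA.
Qed.

Lemma f2mx1 (W : vectType F) : f2mx (\1%VF : 'End(W)) = 1%:M.
Proof.
apply/row_matrixP=> i; rewrite !rowE -[delta_mx 0 i]r2vK -v2r_lfun lfunE /=.
by rewrite mulmx1.
Qed.

Lemma tens_lfun1 : tens_lfun \1%VF \1%VF = \1%VF.
Proof.
apply/lfunP=> w; rewrite lfunE /= !f2mx1 lfunE /=.
suff -> : 1%:M *t 1%:M = 1%:M :> 'M[F]_(dim U * dim V) by rewrite mulmx1.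
apply/matrixP=> i j; case: (mxtens_indexP i) => i1 i2.
case: (mxtens_indexP j) => j1 j2; rewrite tensmxE !mxE -natrM mulnb.
by rewrite (can_eq (@mxtens_indexK _ _)) xpair_eqE.
Qed.

Lemma tens_lfun_comp f f' g g' :
  tens_lfun (f \o f')%VF (g \o g')%VF = (tens_lfun f g \o tens_lfun f' g')%VF.
Proof.
apply/lfunP=> w; rewrite comp_lfunE !lfunE /= !f2mx_comp -mulmxA.
by rewrite -tensmx_mul.
Qed.

End Tensor.

Section DiagTensor.
Variables (A : monoidType) (U V : rep A).
Definition tens_act (x : A) := tens_lfun (act U x) (act V x).
Fact tens_act1 : tens_act 1%g = \1%VF.
Proof. by rewrite /tens_act !act_one tens_lfun1. Qed.
Fact tens_actM x y : tens_act (x * y)%g = (tens_act x \o tens_act y)%VF.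
Proof. by rewrite /tens_act !act_mul tens_lfun_comp. Qed.
Definition tens_rep : rep A := Rep tens_act1 tens_actM.
End DiagTensor.

(* For groups: U (x) V as a module over the direct product. *)
Section OuterTensor.
Variables (gT hT : finGroupType) (U : group_rep gT) (V : group_rep hT).
Definition outer_act (x : gT * hT) := tens_lfun (act U x.1) (act V x.2).
Fact outer_act1 : outer_act 1%g = \1%VF.
Proof. by rewrite /outer_act !(act_one U, act_one V) tens_lfun1. Qed.
Fact outer_actM (x y : gT * hT) :
  outer_act (x * y)%g = (outer_act y \o outer_act x)%VF.
Proof.
by rewrite /outer_act -tens_lfun_comp -(act_mul U) -(act_mul V).
Qed.
Definition outer_rep : group_rep (gT * hT)%type :=
  GroupRep outer_act1 outer_actM.
End OuterTensor.

Record bimod (A B : monoidType) := Bimod {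
  bimod_rep :> rep A;
  ract : B -> 'End(bimod_rep);
  ract_one : ract 1%g = \1%VF;
  ract_mul : forall y z, ract (y * z)%g = (ract z \o ract y)%VF;
  act_ract : forall x y,
    (act bimod_rep x \o ract y = ract y \o act bimod_rep x)%VF }.

(* W (x)_B V = (W (x) V) / < w y (x) v - w (x) y v >. *)
Section BalancedTensor.
Variables (A : monoidType) (B : finGroupType).
Variables (W : bimod A (opgroup B)) (V : group_rep B).

Definition left_act (x : A) := tens_lfun (act W x) (\1%VF : 'End(V)).
Fact left_act1 : left_act 1%g = \1%VF.
Proof. by rewrite /left_act act_one tens_lfun1. Qed.
Fact left_actM x y : left_act (x * y)%g = (left_act x \o left_act y)%VF.
Proof. by rewrite /left_act act_mul -tens_lfun_comp comp_lfun1l. Qed.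
Definition left_tens : rep A := Rep left_act1 left_actM.

Definition balance (y : B) : 'End(left_tens) :=
  tens_lfun (ract W y) \1%VF - tens_lfun \1%VF (act V y).
Definition balanced : {vspace left_tens} := (\sum_(y : B) limg (balance y))%VS.

Fact balanced_stable : stable balanced.
Proof.
move=> x; apply/subvP=> _ /memv_imgP[_ /memv_sumP[u uP ->] ->].
rewrite linear_sum memv_suml // => y _; apply: (subvP (sumv_sup y _ (subvv _))) => //.
have /memv_imgP[w _ ->] := uP y isT.
have E : (left_act x \o balance y = balance y \o left_act x)%VF.
  rewrite /balance /left_act comp_lfunDl comp_lfunDr comp_lfunNl comp_lfunNr.
  by rewrite -!tens_lfun_comp act_ract !comp_lfun1l !comp_lfun1r.
by rewrite /= -comp_lfunE E comp_lfunE memv_img ?memvf.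
Qed.

Definition btens : rep A := quot_rep balanced_stable.
End BalancedTensor.

(* The space F[X] with basis a finite set X, and the linear extension of a
   partial map f : X -> Y, which kills the points where f is not defined. *)
Notation free X := {ffun X -> F^o}.

Section Free.
Definition basis_elt (X : finType) (x : X) : free X := [ffun y => (y == x)%:R].

Definition pmap_fun (X Y : finType) (f : X -> option Y) (a : free X) : free Y :=
  [ffun y => \sum_(x | f x == Some y) a x].

Fact pmap_linear (X Y : finType) (f : X -> option Y) : linear (pmap_fun f).
Proof.
move=> c a b; apply/ffunP=> y; rewrite !ffunE scaler_sumr -big_split.
by apply: eq_bigr => x _; rewrite !ffunE.
Qed.
HB.instance Definition _ (X Y : finType) (f : X -> option Y) :=
  GRing.isLinear.Build F (free X) (free Y) _ (pmap_fun f) (pmap_linear f).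

Definition pmap_lin (X Y : finType) (f : X -> option Y) : 'Hom(free X, free Y) :=
  linfun (pmap_fun f).

Lemma pmap_linE (X Y : finType) (f : X -> option Y) x :
  pmap_lin f (basis_elt x) = if f x is Some y then basis_elt y else 0.
Proof.
rewrite lfunE /=; apply/ffunP=> y; rewrite ffunE.
rewrite (eq_bigr (fun x' => if x' == x then 1 else 0)); last first.
  by move=> x' _; rewrite ffunE; case: eqP.
rewrite -big_mkcondr /= (eq_bigl (fun x' => (x' == x) && (f x == Some y))).
  case fx: (f x) => [z|]; last by rewrite big_pred0 ?ffunE // => x'; rewrite andbF.
  rewrite ffunE (inj_eq Some_inj) eq_sym; case: eqP => _.
    by rewrite (big_pred1 x) // => x'; rewrite andbT.
  by rewrite big_pred0 // => x'; rewrite andbF.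
by move=> x'; rewrite andbC; case: eqP => [->|].
Qed.

Lemma basis_eltP (X : finType) (V : vectType F) (f g : 'Hom(free X, V)) :
  (forall x, f (basis_elt x) = g (basis_elt x)) -> f = g.
Proof.
move=> fg; apply/lfunP=> a.
suff -> : a = \sum_x (a x : F) *: basis_elt x.
  by rewrite !linear_sum; apply: eq_bigr => x _; rewrite !linearZ /= fg.
apply/ffunP=> y; rewrite sum_ffunE (bigD1 y) //= !ffunE eqxx [X in X + _](mulr1 (a y : F)).
rewrite big1 ?addr0 // => x /negPf xy; rewrite !ffunE eq_sym xy.
exact: mulr0.
Qed.

Lemma pmap_lin_comp (X Y Z : finType) (f : Y -> option Z) (g : X -> option Y) :
  (pmap_lin f \o pmap_lin g)%VF = pmap_lin (fun x => obind f (g x)).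
Proof.
apply: basis_eltP => x; rewrite comp_lfunE !pmap_linE.
by case: (g x) => [y|] /=; rewrite ?pmap_linE ?linear0.
Qed.

Lemma eq_pmap_lin (X Y : finType) (f g : X -> option Y) :
  f =1 g -> pmap_lin f = pmap_lin g.
Proof. by move=> fg; apply: basis_eltP => x; rewrite !pmap_linE fg. Qed.

Lemma pmap_lin1 (X : finType) : pmap_lin (@Some X) = \1%VF.
Proof. by apply: basis_eltP => x; rewrite pmap_linE lfunE. Qed.
End Free.

Section ResInd.
Variables (gT : finGroupType).

Section Res.
Variables (H : {group gT}) (V : group_rep gT).
Definition res_act (x : subg_of H) := act V (sgval x).
Fact res_act1 : res_act 1%g = \1%VF.
Proof. exact: act_one V. Qed.
Fact res_actM (x y : subg_of H) :
  res_act (x * y)%g = (res_act y \o res_act x)%VF.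
Proof. exact: (act_mul V (sgval y) (sgval x)). Qed.
Definition res_rep : group_rep (subg_of H) := GroupRep res_act1 res_actM.
End Res.

(* Induction F[G] (x)_F[H] V along a homomorphism f : H -> G. *)
Section Ind.
Variables (hT : finGroupType) (f : {morphism [set: hT] >-> gT}).
(* F[G] with G acting on the left by x.z = z * x and H on the right by
   z.y = f y * z, the products on the right being those of MathComp. *)
Definition lreg (x : gT) : 'End(free gT) := pmap_lin (fun z => Some (z * x)%g).
Definition rreg (y : hT) : 'End(free gT) := pmap_lin (fun z => Some (f y * z)%g).
Fact lreg1 : lreg 1%g = \1%VF.
Proof. by rewrite -pmap_lin1; apply: eq_pmap_lin => z; rewrite mulg1. Qed.
Fact lregM x y : lreg (x * y)%g = (lreg y \o lreg x)%VF.
Proof. by rewrite pmap_lin_comp; apply: eq_pmap_lin => z; rewrite mulgA. Qed.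
Definition lreg_rep : group_rep gT := GroupRep lreg1 lregM.
Fact rreg1 : rreg 1%g = \1%VF.
Proof. by rewrite -pmap_lin1; apply: eq_pmap_lin => z; rewrite morph1 mul1g. Qed.
Fact rregM (x y : opgroup hT) : rreg (x * y)%g = (rreg y \o rreg x)%VF.
Proof.
rewrite pmap_lin_comp; apply: eq_pmap_lin => z /=.
by rewrite mulgA -morphM ?inE.
Qed.
Fact lreg_rreg (x : opgroup gT) (y : opgroup hT) :
  (act lreg_rep x \o rreg y = rreg y \o act lreg_rep x)%VF.
Proof. by rewrite !pmap_lin_comp; apply: eq_pmap_lin => z /=; rewrite mulgA. Qed.
Definition ind_bimod : bimod (opgroup gT) (opgroup hT) :=
  @Bimod (opgroup gT) (opgroup hT) lreg_rep rreg rreg1 rregM lreg_rreg.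
Definition ind_rep (V : group_rep hT) : group_rep gT :=
  btens ind_bimod V.
End Ind.
End ResInd.

End Modules.

Section SetPartitions.
Variable T : finType.
Implicit Types P Q : {set {set T}}.

Definition same_part P : rel T := [rel i j | [exists B in P, (i \in B) && (j \in B)]].

(* The finest partition of T coarser than P and Q; see [join_part_finest]. *)
Definition join_part P Q : {set {set T}} :=
  equivalence_partition (connect (relU (same_part P) (same_part Q))) [set: T].

Lemma same_partP P i j :
  reflect (exists2 B, B \in P & i \in B /\ j \in B) (same_part P i j).
Proof.
apply: (iffP existsP) => [[B /and3P[PB iB jB]] | [B PB [iB jB]]]; exists B => //.
by rewrite PB iB jB.
Qed.

Lemma same_part_sym P : symmetric (same_part P).
Proof. by move=> i j; apply/same_partP/same_partP => -[B PB []]; exists B. Qed.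

Lemma join_sym P Q : connect_sym (relU (same_part P) (same_part Q)).
Proof. by apply: sym_connect_sym => i j /=; rewrite !(same_part_sym _ i). Qed.

Lemma join_equiv P Q :
  {in [set: T] & &, equivalence_rel (connect (relU (same_part P) (same_part Q)))}.
Proof.
move=> i j k _ _ _; split=> [|ij]; first exact: connect0.
exact: (same_connect (join_sym P Q) ij).
Qed.

Lemma join_part_partition P Q : partition (join_part P Q) [set: T].
Proof. exact/equivalence_partitionP/join_equiv. Qed.

Lemma mem_join_part P Q B i j : B \in join_part P Q -> i \in B ->
  (j \in B) = connect (relU (same_part P) (same_part Q)) i j.
Proof.
move=> PB iB; have tr := partition_trivIset (join_part_partition P Q).
rewrite -(pblock_equivalence_partition (@join_equiv P Q)) ?inE //.
by rewrite -/(join_part P Q) (def_pblock tr PB iB).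
Qed.

Lemma join_part_ex P Q i : exists2 B, B \in join_part P Q & i \in B.
Proof.
have := cover_partition (join_part_partition P Q) => cv.
have : i \in cover (join_part P Q) by rewrite cv inE.
by move=> /bigcupP[B]; exists B.
Qed.

Lemma join_part_uniq P Q B C i : B \in join_part P Q -> C \in join_part P Q ->
  i \in B -> i \in C -> B = C.
Proof.
move=> PB PC iB iC; apply/setP=> j.
by rewrite (mem_join_part _ PB iB) (mem_join_part _ PC iC).
Qed.

Definition refines P Q : Prop := forall B, B \in P -> exists2 C, C \in Q & B \subset C.

Lemma join_part_finest P Q (R : {set {set T}}) :
    partition P [set: T] -> partition Q [set: T] -> partition R [set: T] ->
  [/\ refines P (join_part P Q), refines Q (join_part P Q)
    & refines P R -> refines Q R -> refines (join_part P Q) R].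
Proof.
move=> pP pQ pR; split.
- move=> B PB; have /set0Pn[i iB] := partition_neq0 pP PB.
  have [C QC iC] := join_part_ex P Q i; exists C => //.
  apply/subsetP=> j jB; rewrite (mem_join_part _ QC iC) connect1 //=.
  by apply/orP; left; apply/same_partP; exists B.
- move=> B PB; have /set0Pn[i iB] := partition_neq0 pQ PB.
  have [C QC iC] := join_part_ex P Q i; exists C => //.
  apply/subsetP=> j jB; rewrite (mem_join_part _ QC iC) connect1 //=.
  by apply/orP; right; apply/same_partP; exists B.
move=> PR QR B PB; have /set0Pn[i iB] := partition_neq0 (join_part_partition P Q) PB.
have : i \in cover R by rewrite (cover_partition pR) inE.
case/bigcupP=> C RC iC; exists C => //; apply/subsetP=> j.
rewrite (mem_join_part _ PB iB) => /connectP[s + ->] {j}.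
have tR := partition_trivIset pR.
elim: s => [|j s IHs] //= in i iC {B PB iB} *; case/andP=> ij; apply: IHs.
have [D RD [iD jD]] : exists2 D, D \in R & i \in D /\ j \in D.
  case/orP: ij => /same_partP[B PB [iB jB]].
    by have [D RD /subsetP sD] := PR _ PB; exists D => //; split; apply: sD.
  by have [D RD /subsetP sD] := QR _ PB; exists D => //; split; apply: sD.
by rewrite -(def_pblock tR RC iC) (def_pblock tR RD iD).
Qed.

Lemma part_ext P Q : partition P [set: T] -> partition Q [set: T] ->
  same_part P =2 same_part Q -> P = Q.
Proof.
suff sub R S : partition R [set: T] -> partition S [set: T] ->
    same_part R =2 same_part S -> R \subset S.
  by move=> pP pQ e; apply/eqP; rewrite eqEsubset !sub.
move=> pR pS e; apply/subsetP=> B RB.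
have /set0Pn[i iB] := partition_neq0 pR RB.
have : i \in cover S by rewrite (cover_partition pS) inE.
case/bigcupP=> C SC iC; suff -> : B = C by [].
have tR := partition_trivIset pR; have tS := partition_trivIset pS.
apply/setP=> j; apply/idP/idP=> jX.
  have : same_part S i j by rewrite -e; apply/same_partP; exists B.
  case/same_partP=> D SD [iD jD].
  by rewrite -(def_pblock tS SC iC) (def_pblock tS SD iD).
have : same_part R i j by rewrite e; apply/same_partP; exists C.
case/same_partP=> D SD [iD jD].
by rewrite -(def_pblock tR RB iB) (def_pblock tR SD iD).
Qed.

End SetPartitions.

Section DualSymmetricInverseMonoid.
Variable n : nat.
Local Notation graph := {set {set 'I_n} * {set 'I_n}}.

(* An element of I_n^* is encoded by the graph of its bijection: the set of the
   pairs (A, image of A) where A runs over the parts of the domain. *)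
Definition is_bij_graph (G : graph) : bool :=
  [&& partition [set p.1 | p in G] [set: 'I_n],
      partition [set p.2 | p in G] [set: 'I_n],
      #|[set p.1 | p in G]| == #|G| & #|[set p.2 | p in G]| == #|G|].

(* The dual symmetric inverse monoid I_n^*. *)
Record dsim := Dsim { dgraph :> graph; dgraphP : is_bij_graph dgraph }.
HB.instance Definition _ := [isSub for dgraph].
HB.instance Definition _ := [Finite of dsim by <:].

Definition idom (x : dsim) : {set {set 'I_n}} := [set p.1 | p in dgraph x].
Definition icod (x : dsim) : {set {set 'I_n}} := [set p.2 | p in dgraph x].

Lemma bij_graphP (G : graph) :
  reflect [/\ (forall i, exists2 p, p \in G & i \in p.1),
              (forall i, exists2 p, p \in G & i \in p.2),
              (forall p q i, p \in G -> q \in G -> i \in p.1 -> i \in q.1 -> p = q),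
              (forall p q i, p \in G -> q \in G -> i \in p.2 -> i \in q.2 -> p = q)
            & (forall p, p \in G -> (exists i, i \in p.1) /\ (exists i, i \in p.2))]
          (is_bij_graph G).
Proof.
have partP (f : {set 'I_n} * {set 'I_n} -> {set 'I_n}) :
  reflect [/\ (forall i, exists2 p, p \in G & i \in f p),
     (forall p q i, p \in G -> q \in G -> i \in f p -> i \in f q -> p = q)
    & (forall p, p \in G -> exists i, i \in f p)]
   (partition [set f p | p in G] [set: 'I_n] && (#|[set f p | p in G]| == #|G|)).
  apply: (iffP andP) => [[pG /imset_injP injf] | [tot uni ne]].
    split=> [i|p q i Gp Gq ip iq|p Gp].
    - have : i \in cover [set f p | p in G] by rewrite (cover_partition pG) inE.
      by case/bigcupP=> _ /imsetP[p Gp ->]; exists p.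
    - have tG := partition_trivIset pG; apply: injf => //.
      by rewrite -(def_pblock tG _ ip) ?imset_f // (def_pblock tG _ iq) ?imset_f.
    - by apply/set0Pn; rewrite (partition_neq0 pG) ?imset_f.
  split; last first.
    apply/imset_injP=> p q Gp Gq e; have [i ip] := ne p Gp.
    by apply: (uni p q i) => //; rewrite -e.
  apply/and3P; split.
  - rewrite eqEsubset subsetT; apply/subsetP=> i _; have [p Gp ip] := tot i.
    by apply/bigcupP; exists (f p); rewrite ?imset_f.
  - apply/trivIsetP=> _ _ /imsetP[p Gp ->] /imsetP[q Gq ->] npq.
    rewrite -setI_eq0; apply/set0Pn=> -[i /setIP[ip iq]].
    by rewrite (uni p q i) ?eqxx in npq.
  - apply/imsetP=> -[p /ne[i]] + e.
    by rewrite -e inE.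
rewrite /is_bij_graph; have P1 := partP fst; have P2 := partP snd.
rewrite (_ : [&& _, _, _ & _] = (partition [set p.1 | p in G] [set: 'I_n] && (#|[set p.1 | p in G]| == #|G|))
  && (partition [set p.2 | p in G] [set: 'I_n] && (#|[set p.2 | p in G]| == #|G|))); last first.
  by rewrite [RHS]andbACA -andbA.
apply: (iffP andP) => [[/P1[a b c] /P2[a' b' c']] | [a a' b b' c]].
  by split=> // p Gp; split; [apply: c | apply: c'].
by split; [apply/P1 | apply/P2]; split=> // p /c[].
Qed.

Definition irel (x : dsim) (i j : 'I_n) : Prop :=
  exists2 p, p \in dgraph x & i \in p.1 /\ j \in p.2.

(* The right-to-left product: [imul x z] is z followed by x. *)
Definition imul_graph (x z : dsim) : graph :=
  [set (\bigcup_(p in dgraph z | p.2 \subset B) p.1,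
        \bigcup_(p in dgraph x | p.1 \subset B) p.2)
     | B : {set 'I_n} in join_part (icod z) (idom x)].

Lemma sub_join2 (x z : dsim) p i (B : {set 'I_n}) : p \in dgraph z -> i \in p.2 ->
  B \in join_part (icod z) (idom x) -> (p.2 \subset B) = (i \in B).
Proof.
move=> zp ip PB; apply/subsetP/idP=> [-> // | iB j jp].
rewrite (mem_join_part _ PB iB) connect1 //=; apply/orP; left.
by apply/same_partP; exists p.2; rewrite ?imset_f.
Qed.

Lemma sub_join1 (x z : dsim) p i (B : {set 'I_n}) : p \in dgraph x -> i \in p.1 ->
  B \in join_part (icod z) (idom x) -> (p.1 \subset B) = (i \in B).
Proof.
move=> zp ip PB; apply/subsetP/idP=> [-> // | iB j jp].
rewrite (mem_join_part _ PB iB) connect1 //=; apply/orP; right.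
by apply/same_partP; exists p.1; rewrite ?imset_f.
Qed.

Lemma imul_graphP (x z : dsim) : is_bij_graph (imul_graph x z).
Proof.
have [x1 x2 u1 u2 xn] := bij_graphP _ (dgraphP x).
have [z1 z2 v1 v2 zn] := bij_graphP _ (dgraphP z).
apply/bij_graphP; split.
- move=> i; have [p zp ip] := z1 i; have [_ [c cp]] := zn p zp.
  have [B PB cB] := join_part_ex (icod z) (idom x) c.
  eexists; first by apply: imset_f PB.
  by apply/bigcupP; exists p; rewrite ?zp ?(sub_join2 zp cp PB).
- move=> i; have [p xp ip] := x2 i; have [[c cp] _] := xn p xp.
  have [B PB cB] := join_part_ex (icod z) (idom x) c.
  eexists; first by apply: imset_f PB.
  by apply/bigcupP; exists p; rewrite ?xp ?(sub_join1 xp cp PB).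
- move=> _ _ i /imsetP[B PB ->] /imsetP[C PC ->] /=.
  case/bigcupP=> p /andP[zp pB] ip /bigcupP[q /andP[zq qC] iq].
  have qp := v1 _ _ _ zp zq ip iq; rewrite -{}qp {zq iq} in qC.
  have [_ [c cp]] := zn p zp.
  by rewrite (join_part_uniq PB PC (subsetP pB c cp) (subsetP qC c cp)).
- move=> _ _ i /imsetP[B PB ->] /imsetP[C PC ->] /=.
  case/bigcupP=> p /andP[xp pB] ip /bigcupP[q /andP[xq qC] iq].
  have qp := u2 _ _ _ xp xq ip iq; rewrite -{}qp {xq iq} in qC.
  have [[c cp] _] := xn p xp.
  by rewrite (join_part_uniq PB PC (subsetP pB c cp) (subsetP qC c cp)).
move=> _ /imsetP[B PB ->] /=.
have /set0Pn[c cB] := partition_neq0 (join_part_partition _ _) PB.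
have [p xp cp] := x1 c; have [q zq cq] := z2 c.
have [_ [i ip]] := xn p xp; have [[j jq] _] := zn q zq.
split; [exists j | exists i]; apply/bigcupP.
  by exists q; rewrite ?zq ?(sub_join2 zq cq PB).
by exists p; rewrite ?xp ?(sub_join1 xp cp PB).
Qed.

Definition imul (x z : dsim) : dsim := Dsim (imul_graphP x z).

Definition ione_graph : graph := [set ([set i], [set i]) | i : 'I_n].

Lemma ione_graphP : is_bij_graph ione_graph.
Proof.
apply/bij_graphP; split=> [i|i|p q i|p q i|p].
- by exists ([set i], [set i]); rewrite ?imset_f ?inE.
- by exists ([set i], [set i]); rewrite ?imset_f ?inE.
- by case/imsetP=> a _ -> /imsetP[b _ ->] /set1P-> /set1P->.
- by case/imsetP=> a _ -> /imsetP[b _ ->] /set1P-> /set1P->.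
- by case/imsetP=> a _ ->; split; exists a; apply/set1P.
Qed.

Definition ione : dsim := Dsim ione_graphP.

Definition difun (Q : 'I_n -> 'I_n -> Prop) : Prop :=
  forall i j i' j', Q i j -> Q i' j -> Q i' j' -> Q i j'.

Lemma irel_difun x : difun (irel x).
Proof.
have [_ _ u1 u2 _] := bij_graphP _ (dgraphP x).
move=> i j i' j' [p xp [ip jp]] [q xq [iq jq]] [r xr [ir jr]].
exists p => //; split=> //.
by rewrite (u2 p q j) // (u1 q r i').
Qed.

Lemma irel_tot1 x i : exists j, irel x i j.
Proof.
have [x1 _ _ _ xn] := bij_graphP _ (dgraphP x).
by have [p xp ip] := x1 i; have [_ [j jp]] := xn p xp; exists j, p.
Qed.

Lemma irel_tot2 x j : exists i, irel x i j.
Proof.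
have [_ x2 _ _ xn] := bij_graphP _ (dgraphP x).
by have [p xp jp] := x2 j; have [[i ip] _] := xn p xp; exists i, p.
Qed.

Lemma irel_ext x y : (forall i j, irel x i j <-> irel y i j) -> x = y.
Proof.
move=> e; apply: val_inj; apply/eqP; rewrite eqEsubset /=.
suff sub u v : (forall i j, irel u i j <-> irel v i j) -> dgraph u \subset dgraph v.
  by rewrite !sub // => i j; symmetry.
move=> {}e; apply/subsetP=> p up.
have [_ _ u1 u2 un] := bij_graphP _ (dgraphP u).
have [_ _ v1 v2 _] := bij_graphP _ (dgraphP v).
have [[i ip] [j jp]] := un p up.
have /e[q vq [iq jq]] : irel u i j by exists p.
suff -> : p = q by [].
have eq1 : p.1 = q.1.
  apply/setP=> a; apply/idP/idP=> aX.
    have /e[r vr [ar jr]] : irel u a j by exists p.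
    by rewrite -(v2 r q j).
  have /e[r vr [ar jr]] : irel v a j by exists q.
  by rewrite (u2 p r j).
have eq2 : p.2 = q.2.
  apply/setP=> a; apply/idP/idP=> aX.
    have /e[r vr [ar jr]] : irel u i a by exists p.
    by rewrite -(v1 r q i).
  have /e[r vr [ar jr]] : irel v i a by exists q.
  by rewrite (u1 p r i).
by case: (p) (q) eq1 eq2 => ? ? [? ?] /= -> ->.
Qed.

Lemma irel_comp x z i c j : irel z i c -> irel x c j -> irel (imul x z) i j.
Proof.
case=> p zp [ip cp] [q xq [cq jq]].
have [B PB cB] := join_part_ex (icod z) (idom x) c.
eexists; first by apply: imset_f PB.
split; apply/bigcupP; [exists p | exists q] => //.
  by rewrite zp (sub_join2 zp cp PB).
by rewrite xq (sub_join1 xq cq PB).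
Qed.

Lemma irel_min x z (Q : 'I_n -> 'I_n -> Prop) : difun Q ->
    (forall i c j, irel z i c -> irel x c j -> Q i j) ->
  forall i j, irel (imul x z) i j -> Q i j.
Proof.
move=> dQ zxQ i j [_ /imsetP[B PB ->] []] /=.
case/bigcupP=> p /andP[zp pB] ip /bigcupP[q /andP[xq qB] jq].
have [_ _ _ _ zn] := bij_graphP _ (dgraphP z).
have [_ _ _ _ xn] := bij_graphP _ (dgraphP x).
have [_ [c cp]] := zn p zp; have [[d dq] _] := xn q xq.
have cB := subsetP pB c cp; have := subsetP qB d dq.
rewrite (mem_join_part _ PB cB) => /connectP[s pth ed].
have dj : irel x d j by exists q.
have : forall j, irel x c j -> Q i j.
  by move=> k; apply: zxQ; exists p.
move: pth ed dj; clear - dQ zxQ; elim: s c j => [|e s IHs] c j /=.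
  by move=> _ -> dj; apply.
case/andP=> ce pth ed dj cQ; apply: IHs (pth) ed dj _ => k ek.
case/orP: ce => /same_partP[_ /imsetP[r yr ->] [cr er]].
  have [a ar] : exists a, a \in r.1.
    by have [_ _ _ _ /(_ r yr)[]] := bij_graphP _ (dgraphP z).
  have [m cm] := irel_tot1 x c.
  apply: (dQ i m a k); first exact: cQ.
    by apply: zxQ cm; exists r.
  by apply: zxQ ek; exists r.
apply: cQ; have [m mr] : exists m, m \in r.2.
  by have [_ _ _ _ /(_ r yr)[]] := bij_graphP _ (dgraphP x).
apply: (@irel_difun x c m e k) => //; by exists r.
Qed.

Lemma irel_one i j : irel ione i j <-> i = j.
Proof.
split=> [[_ /imsetP[a _ ->] [/set1P-> /set1P->]] // | <-].
by exists ([set i], [set i]); rewrite ?imset_f ?inE.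
Qed.

Fact imulA : associative imul.
Proof.
move=> x y z; apply: irel_ext => i j; split.
  apply: (irel_min (@irel_difun _)) => {}i c {}j yz xcj.
  pose Q a b := forall k, irel x b k -> irel (imul (imul x y) z) a k.
  suff : Q i c by apply.
  apply: irel_min yz => [a b a' b' ab a'b a'b' k xk | a d b za yb k xk].
    have [k' xk'] := irel_tot1 x b.
    by apply: (irel_difun (ab _ xk') (a'b _ xk')); apply: a'b'.
  exact: irel_comp za (irel_comp yb xk).
apply: (irel_min (@irel_difun _)) => {}i c {}j zic xy.
pose Q b k := forall a, irel z a b -> irel (imul x (imul y z)) a k.
suff : Q c j by apply.
apply: irel_min xy => [a b a' b' ab a'b a'b' k zk | a d b ya xb k zk].
  have [k' zk'] := irel_tot2 z a'.
  by apply: (irel_difun (ab _ zk) (a'b _ zk')); apply: a'b'.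
exact: irel_comp (irel_comp zk ya) xb.
Qed.

Fact imul1 : left_id ione imul.
Proof.
move=> z; apply: irel_ext => i j; split=> [|zij].
  by apply: (irel_min (@irel_difun _)) => {}i c {}j zic /irel_one <-.
by apply: irel_comp zij _; apply/irel_one.
Qed.

Fact imulr1 : right_id ione imul.
Proof.
move=> z; apply: irel_ext => i j; split=> [|zij].
  by apply: (irel_min (@irel_difun _)) => {}i c {}j /irel_one <-.
by apply: irel_comp zij; apply/irel_one.
Qed.

HB.instance Definition _ := isMonoid.Build dsim imulA imul1 imulr1.

Lemma idom_partition x : partition (idom x) [set: 'I_n].
Proof. by have /and4P[] := dgraphP x. Qed.

Lemma same_idomP x i i' :
  reflect (exists j, irel x i j /\ irel x i' j) (same_part (idom x) i i').
Proof.
have [_ _ _ u2 xn] := bij_graphP _ (dgraphP x).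
apply: (iffP (same_partP _ _ _)) => [[_ /imsetP[p xp ->] [ip i'p]] | [j []]].
  by have [_ [j jp]] := xn p xp; exists j; split; exists p.
case=> p xp [ip jp] [q xq [iq jq]]; rewrite -(u2 p q j) // in iq.
by exists p.1; rewrite ?imset_f.
Qed.

Lemma same_idom_mul x z i i' :
  same_part (idom z) i i' -> same_part (idom (imul x z)) i i'.
Proof.
case/same_idomP=> c [zi zi']; have [j xj] := irel_tot1 x c.
by apply/same_idomP; exists j; split; apply: irel_comp xj.
Qed.

Lemma idom_mul_factor x y z :
  idom (imul x (imul y z)) = idom z -> idom (imul y z) = idom z.
Proof.
move=> e; apply: part_ext (idom_partition _) (idom_partition _) _ => i j.
apply/idP/idP; last exact: same_idom_mul.
by move=> /(same_idom_mul x); rewrite e.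
Qed.

End DualSymmetricInverseMonoid.

(* A set partition of {0, ..., n-1} of rank k, with a labelling of its parts. *)
Record lpart (n k : nat) := Lpart {
  part_of :> 'I_k -> {set 'I_n};
  part_of_inj : injective part_of;
  part_ofP : partition [set part_of a | a : 'I_k] [set: 'I_n] }.

Section CellModule.
Variables (n k : nat) (rho : lpart n k).
Local Notation parts := [set rho a | a : 'I_k].

(* The element of S_rho which permutes the parts of rho as s does the labels. *)
Definition sgraph (s : 'S_k) := [set (rho a, rho (s a)) | a : 'I_k].

Lemma rho_ex i : exists a, i \in rho a.
Proof.
have : i \in cover parts by rewrite (cover_partition (part_ofP rho)) inE.
by case/bigcupP=> _ /imsetP[a _ ->]; exists a.
Qed.

Lemma rho_uniq i a b : i \in rho a -> i \in rho b -> a = b.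
Proof.
move=> ia ib; apply: (@part_of_inj _ _ rho).
have tr := partition_trivIset (part_ofP rho).
by rewrite -(def_pblock tr _ ia) ?imset_f // (def_pblock tr _ ib) ?imset_f.
Qed.

Lemma rho_ne a : exists i, i \in rho a.
Proof. by apply/set0Pn; rewrite (partition_neq0 (part_ofP rho)) ?imset_f. Qed.

Lemma sgraphP s : is_bij_graph (sgraph s).
Proof.
apply/bij_graphP; split=> [i|i|p q i|p q i|p].
- by have [a ia] := rho_ex i; exists (rho a, rho (s a)); rewrite ?imset_f.
- have [a ia] := rho_ex i; exists (rho (s^-1%g a), rho (s (s^-1%g a))).
    by rewrite imset_f.
  by rewrite permKV.
- by case/imsetP=> a _ -> /imsetP[b _ ->] /= /rho_uniq ia /ia ->.
- by case/imsetP=> a _ -> /imsetP[b _ ->] /= /rho_uniq ia /ia /perm_inj ->.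
- by case/imsetP=> a _ ->; split; apply: rho_ne.
Qed.

Definition sdsim (s : 'S_k) : dsim n := Dsim (sgraphP s).

Lemma sdsim_idom s : idom (sdsim s) = parts.
Proof. by rewrite /idom /= /sgraph -imset_comp; apply: eq_imset. Qed.

Lemma sdsim_icod s : icod (sdsim s) = parts.
Proof.
rewrite /icod /= /sgraph -imset_comp; apply/setP=> B; apply/imsetP/imsetP.
  by case=> a _ ->; exists (s a).
by case=> a _ ->; exists (s^-1%g a); rewrite //= permKV.
Qed.

Lemma irel_sdsim s i j :
  irel (sdsim s) i j <-> exists2 a, i \in rho a & j \in rho (s a).
Proof.
split=> [[_ /imsetP[a _ ->] [ia ja]] | [a ia ja]]; first by exists a.
by exists (rho a, rho (s a)); rewrite ?imset_f.
Qed.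

Lemma same_rhoP i j :
  reflect (exists2 a, i \in rho a & j \in rho a) (same_part parts i j).
Proof.
apply: (iffP (same_partP _ _ _)) => [[_ /imsetP[a _ ->] [ia ja]] | [a ia ja]].
  by exists a.
by exists (rho a); rewrite ?imset_f.
Qed.

Definition coarser (x : dsim n) := forall i j,
  same_part parts i j -> same_part (idom x) i j.

Lemma irel_mul_sdsim x s i j : coarser x ->
  irel (imul x (sdsim s)) i j <->
  exists a c, [/\ i \in rho a, c \in rho (s a) & irel x c j].
Proof.
move=> cx; split; last first.
  case=> a [c [ia ca xc]]; apply: irel_comp xc.
  by apply/irel_sdsim; exists a.
apply: (@irel_min n x (sdsim s) (fun i j => exists a c,
  [/\ i \in rho a, c \in rho (s a) & irel x c j])); last by move=> {}i c {}j /irel_sdsim[a ia ca] xc; exists a, c.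
move=> {}i {}j i' j' [a [c [ia ca xc]]] [b [d [ib db xd]]] [b' [d' [ib' db' xd']]].
rewrite -(rho_uniq ib ib') in db'.
have /same_idomP[e [xde xd'e]] : same_part (idom x) d d'.
  by apply: cx; apply/same_rhoP; exists (s b).
exists a, c; split=> //; apply: (irel_difun xc xd).
exact: (irel_difun xde xd'e).
Qed.

Lemma coarser_mul x s : coarser (imul x (sdsim s)).
Proof.
move=> i j; rewrite -(sdsim_idom s); exact: same_idom_mul.
Qed.

Lemma coarser_idom x : idom x = parts -> coarser x.
Proof. by move=> e i j; rewrite e. Qed.

Lemma coarser_mull x z : coarser z -> coarser (imul x z).
Proof. by move=> cz i j /cz; apply: same_idom_mul. Qed.

Lemma sdsim1 x : coarser x -> imul x (sdsim 1%g) = x.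
Proof.
move=> cx; apply: irel_ext => i j; rewrite irel_mul_sdsim //; split.
  case=> a [c [ia]]; rewrite perm1 => ca xc.
  have /same_idomP[e [xie xce]] : same_part (idom x) i c.
    by apply: cx; apply/same_rhoP; exists a.
  exact: (irel_difun xie xce).
by move=> xi; have [a ia] := rho_ex i; exists a, i; rewrite perm1.
Qed.

Lemma sdsimM s t : imul (sdsim t) (sdsim s) = sdsim (s * t)%g.
Proof.
apply: irel_ext => i j; rewrite irel_mul_sdsim; last first.
  by apply: coarser_idom; apply: sdsim_idom.
rewrite irel_sdsim; split.
  case=> a [c [ia ca /irel_sdsim[b cb jb]]]; exists a => //.
  by rewrite permM (rho_uniq ca cb).
case=> a ia; rewrite permM => ja; have [c ca] := rho_ne (s a).
by exists a, c; split=> //; apply/irel_sdsim; exists (s a).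
Qed.

Lemma idom_mul_sdsim x s : idom x = parts -> idom (imul x (sdsim s)) = parts.
Proof.
move=> e; have cx := coarser_idom e.
apply: part_ext (idom_partition _) (part_ofP rho) _ => i j.
apply/idP/idP; last exact: coarser_mul.
case/same_idomP=> m [/irel_mul_sdsim[//|a [c [ia ca xc]]]].
case/irel_mul_sdsim=> // b [d [jb db xd]].
have : same_part (idom x) c d by apply/same_idomP; exists m.
rewrite e => /same_rhoP[f cf df]; apply/same_rhoP; exists a => //.
suff -> : a = b by [].
apply: (@perm_inj _ s).
by rewrite -(rho_uniq cf ca) (rho_uniq df db).
Qed.

Lemma idom_mul_sdsimE x s : coarser x ->
  (idom (imul x (sdsim s)) == parts) = (idom x == parts).
Proof.
move=> cx; apply/eqP/eqP => [e | /idom_mul_sdsim//].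
by rewrite -(sdsim1 cx) -(mulVg s) -sdsimM imulA idom_mul_sdsim.
Qed.

(* L_rho, and the cell module F[L_rho]: [insub y] is [Some y] if y lies in
   L_rho and [None] otherwise. *)
Definition cell : predArgType := {x : dsim n | idom x == parts}.
HB.instance Definition _ := Finite.on cell.

Definition cell_left (x : dsim n) (z : cell) : option cell := insub (imul x (val z)).
Definition cell_right (s : 'S_k) (z : cell) : option cell :=
  insub (imul (val z) (sdsim s)).

Lemma cell_rightE s z :
  exists2 z', cell_right s z = Some z' & val z' = imul (val z) (sdsim s).
Proof.
rewrite /cell_right; case: insubP => [z' _ zz' | /negP[]]; first by exists z'.
by have /eqP e := valP z; apply/eqP/idom_mul_sdsim.
Qed.

Lemma cell_leftM x y z :
  cell_left (imul x y) z = obind (cell_left x) (cell_left y z).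
Proof.
rewrite /cell_left -imulA; case: (insubP _ (imul y (val z))) => [z' _ e | nyz] /=.
  by rewrite -e.
rewrite insubN //; apply: contra nyz => /eqP e.
have /eqP ez := valP z.
apply/eqP; rewrite -[RHS]ez; apply: (@idom_mul_factor _ x); exact: etrans (esym ez).
Qed.

Variable F : fieldType.

Definition cell_act (x : dsim n) : 'End({ffun cell -> F^o}) := pmap_lin F (cell_left x).
Fact cell_act1 : cell_act 1%g = \1%VF.
Proof.
rewrite -pmap_lin1; apply: eq_pmap_lin => z.
by rewrite /cell_left imul1 valK.
Qed.
Fact cell_actM (x y : dsim n) : cell_act (x * y)%g = (cell_act x \o cell_act y)%VF.
Proof.
by rewrite pmap_lin_comp; apply: eq_pmap_lin => z; apply: cell_leftM.
Qed.
Definition cell_rep : rep F (dsim n) := Rep cell_act1 cell_actM.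

Definition cell_ract (s : 'S_k) : 'End({ffun cell -> F^o}) := pmap_lin F (cell_right s).
Fact cell_ract1 : cell_ract 1%g = \1%VF.
Proof.
rewrite -pmap_lin1; apply: eq_pmap_lin => z.
rewrite /cell_right sdsim1 ?valK //.
by have /eqP ez := valP z; apply: coarser_idom.
Qed.
Fact cell_ractM (s t : opgroup 'S_k) :
  cell_ract (s * t)%g = (cell_ract t \o cell_ract s)%VF.
Proof.
rewrite pmap_lin_comp; apply: eq_pmap_lin => z.
have [z' -> e] := cell_rightE s z.
by rewrite /= /cell_right e -imulA sdsimM.
Qed.
Fact cell_act_ract (x : dsim n) (s : opgroup 'S_k) :
  (act cell_rep x \o cell_ract s = cell_ract s \o act cell_rep x)%VF.
Proof.
rewrite !pmap_lin_comp; apply: eq_pmap_lin => z.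
have [z' -> e] := cell_rightE s z; rewrite /= /cell_left e imulA.
case: (insubP _ (imul x (val z))) => [z'' _ e'' | nxz] /=.
  by rewrite /cell_right e''.
rewrite insubN // idom_mul_sdsimE //.
by have /eqP ez := valP z; apply/coarser_mull/coarser_idom.
Qed.
Definition cell_bimod : bimod F (dsim n) (opgroup 'S_k) :=
  @Bimod F (dsim n) (opgroup 'S_k) cell_rep cell_ract cell_ract1 cell_ractM
    cell_act_ract.

End CellModule.

Record intpart (k : nat) := Intpart {
  intpart_seq :> seq nat;
  intpartP : [&& sorted geq intpart_seq, 0%N \notin intpart_seq
                & sumn intpart_seq == k] }.

(* The cells of the Young diagram of lambda are numbered row after row; a
   tableau is a permutation t, with t c the entry in the cell number c. *)
Section Specht.
Variables (F : fieldType) (k : nat) (la : intpart k).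
Implicit Types t s : 'S_k.

Definition row_of t (i : 'I_k) : nat := reshape_index la (t^-1%g i).
Definition col_of t (i : 'I_k) : nat := reshape_offset la (t^-1%g i).

(* The row equivalence class of the tableau t. *)
Definition tabloid t : {set 'S_k} := [set u | [forall i, row_of u i == row_of t i]].

Definition col_stab t : {set 'S_k} :=
  [set s : 'S_k | [forall i, col_of t (s i) == col_of t i]].

Local Notation M := {ffun {set 'S_k} -> F^o}.

Definition polytabloid t : M :=
  \sum_(s in col_stab t) (-1) ^+ s *: basis_elt F (tabloid (t * s)%g).

Definition specht_space : {vspace M} := <<[seq polytabloid t | t : 'S_k]>>%VS.

(* Here u * s is the tableau obtained by applying s to the entries of u. *)
Definition perm_act s : 'End(M) :=
  pmap_lin F (fun T : {set 'S_k} => Some [set (u * s)%g | u in T]).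
Fact perm_act1 : perm_act 1%g = \1%VF.
Proof.
rewrite -pmap_lin1; apply: eq_pmap_lin => T; congr Some.
by rewrite -[RHS]imset_id; apply: eq_imset => u; rewrite mulg1.
Qed.
Fact perm_actM s t : perm_act (s * t)%g = (perm_act t \o perm_act s)%VF.
Proof.
rewrite pmap_lin_comp; apply: eq_pmap_lin => T; congr Some.
by rewrite -imset_comp; apply: eq_imset => u; rewrite /= mulgA.
Qed.
Definition perm_rep : group_rep F 'S_k := GroupRep perm_act1 perm_actM.

Lemma row_ofM t s i : row_of (t * s)%g (s i) = row_of t i.
Proof. by rewrite /row_of invMg permM permK. Qed.

Lemma col_ofM t s i : col_of (t * s)%g (s i) = col_of t i.
Proof. by rewrite /col_of invMg permM permK. Qed.

Lemma tabloidM t s : [set (u * s)%g | u in tabloid t] = tabloid (t * s)%g.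
Proof.
apply/setP=> v; apply/imsetP/idP=> [[u] | ].
  rewrite !inE => /forallP tu ->; apply/forallP=> i.
  by rewrite -(permKV s i) !row_ofM tu.
rewrite inE => /forallP tv; exists (v * s^-1)%g; last by rewrite mulgKV.
rewrite inE; apply/forallP=> i.
by rewrite -(row_ofM t s) -(row_ofM (v * s^-1)%g s) mulgKV.
Qed.

Lemma perm_act_polytabloid t s :
  perm_act s (polytabloid t) = polytabloid (t * s)%g.
Proof.
rewrite linear_sum /polytabloid [RHS](reindex_inj (conjg_inj s)) /=.
apply: eq_big => [u | u _].
  rewrite !inE; apply/forallP/forallP=> h i.
    by rewrite -(permKV s i) permJ !col_ofM.
  by rewrite -(col_ofM t s) -(col_ofM t s i) -permJ; apply: h.
rewrite linearZ /= pmap_linE odd_permJ; congr (_ *: basis_elt F _).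
by rewrite tabloidM -!mulgA -conjgC.
Qed.

Fact specht_stable : @stable F (opgroup 'S_k) perm_rep specht_space.
Proof.
move=> s; rewrite limg_span; apply/span_subvP=> _ /mapP[_ /mapP[t _ ->] ->].
by rewrite [act _ _ _]perm_act_polytabloid memv_span ?image_f.
Qed.

Definition specht : group_rep F 'S_k := sub_rep specht_stable.

End Specht.

(* N^lambda, built from the set partition rho; the labelling of the parts of
   rho identifies S_rho with S_k. *)
Definition cell_simple (F : fieldType) (n k : nat) (rho : lpart n k)
  (la : intpart k) : rep F (dsim n) := btens (cell_bimod rho F) (specht F la).

Section ZeroOneMatrices.
Variables k l m : nat.

Definition ones (M : 'M[bool]_(k, l)) : {set 'I_k * 'I_l} := [set p | M p.1 p.2].

Definition is_Qmat (M : 'M[bool]_(k, l)) : bool :=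
  [&& #|ones M| == m, [forall i, exists j, M i j] & [forall j, exists i, M i j]].

Definition Qmat : predArgType := {M : 'M[bool]_(k, l) | is_Qmat M}.
HB.instance Definition _ := Finite.on Qmat.

Implicit Type M : Qmat.

(* Row i is moved to row g.1 i and column j to column g.2 j. *)
Definition perm_mat (g : 'S_k * 'S_l) (M : 'M[bool]_(k, l)) : 'M[bool]_(k, l) :=
  \matrix_(i, j) M (g.1^-1%g i) (g.2^-1%g j).

Definition perm_cell (g : 'S_k * 'S_l) (p : 'I_k * 'I_l) := (g.1 p.1, g.2 p.2).

Lemma perm_cell_inj g : injective (perm_cell g).
Proof. by move=> [i j] [i' j'] [/perm_inj-> /perm_inj->]. Qed.

Lemma perm_cellM g h p : perm_cell (g * h)%g p = perm_cell h (perm_cell g p).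
Proof. by rewrite /perm_cell /= !permM. Qed.

Lemma ones_perm_mat g (M : 'M[bool]_(k, l)) :
  ones (perm_mat g M) = [set perm_cell g p | p in ones M].
Proof.
apply/setP=> -[i j]; rewrite inE mxE /=; apply/idP/imsetP=> [Mij | [[a b]]].
  by exists (g.1^-1%g i, g.2^-1%g j); rewrite ?inE // /perm_cell /= !permKV.
by rewrite inE /= => Mab [-> ->]; rewrite !permK.
Qed.

Lemma perm_mat_is_Qmat g M : is_Qmat (perm_mat g (val M)).
Proof.
have /and3P[cM /forallP rM /forallP lM] := valP M; apply/and3P; split.
- by rewrite ones_perm_mat card_imset //; apply: perm_cell_inj.
- apply/forallP=> i; have /existsP[j Mij] := rM (g.1^-1%g i).
  by apply/existsP; exists (g.2 j); rewrite mxE permK.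
- apply/forallP=> j; have /existsP[i Mij] := lM (g.2^-1%g j).
  by apply/existsP; exists (g.1 i); rewrite mxE permK.
Qed.

Definition Qact_fun M (g : 'S_k * 'S_l) : Qmat := Sub (perm_mat g (val M)) (perm_mat_is_Qmat g M).

Fact Qact_1 : Qact_fun^~ 1%g =1 id.
Proof. by move=> M; apply/val_inj/matrixP=> i j; rewrite mxE !invg1 !perm1. Qed.
Fact Qact_M M : act_morph Qact_fun M.
Proof.
by move=> g h; apply/val_inj/matrixP=> i j; rewrite !mxE !invMg !permM.
Qed.
Canonical Qact := TotalAction Qact_1 Qact_M.

Definition Qstab M : {group 'S_k * 'S_l} := 'C[M | Qact]%G.

(* A bijection between {0, ..., m-1} and the entries of M equal to 1. *)
Record ones_label M := OnesLabel {
  ones_lab :> 'I_m -> 'I_k * 'I_l;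
  ones_lab_inj : injective ones_lab;
  ones_labP : [set ones_lab a | a : 'I_m] = ones (val M) }.

Section OnesPerm.
Variables (M : Qmat) (b : ones_label M).

Lemma Qstab_ones (g : subg_of (Qstab M)) p :
  p \in ones (val M) -> perm_cell (sgval g) p \in ones (val M).
Proof.
move=> pM; have /astab1P e : sgval g \in 'C[M | Qact]%g by apply: subgP.
have /= e' : perm_mat (sgval g) (val M) = val M := congr1 val e.
by rewrite -[X in _ \in ones X]e' ones_perm_mat imset_f.
Qed.

(* The label of the entry to which g moves the entry labelled by a. *)
Definition ones_perm_fun (g : subg_of (Qstab M)) (a : 'I_m) : 'I_m :=
  odflt a [pick c | b c == perm_cell (sgval g) (b a)].

Lemma ones_perm_funE (g : subg_of (Qstab M)) a : b (ones_perm_fun g a) = perm_cell (sgval g) (b a).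
Proof.
rewrite /ones_perm_fun; case: pickP => [c /eqP // | nb].
have : perm_cell (sgval g) (b a) \in ones (val M).
  by apply: Qstab_ones; rewrite -(ones_labP b) imset_f.
by rewrite -(ones_labP b) => /imsetP[c _ /eqP]; rewrite eq_sym nb.
Qed.

Lemma ones_perm_inj (g : subg_of (Qstab M)) : injective (ones_perm_fun g).
Proof.
move=> a c /(congr1 b); rewrite !ones_perm_funE => /perm_cell_inj.
exact: ones_lab_inj.
Qed.

Definition ones_perm (g : subg_of (Qstab M)) : 'S_m := perm (@ones_perm_inj g).

Lemma ones_permM : {in [set: subg_of (Qstab M)] &, {morph ones_perm : g h / (g * h)%g}}.
Proof.
move=> g h _ _; apply/permP=> a; apply: (@ones_lab_inj _ b).
by rewrite permM !permE !ones_perm_funE perm_cellM.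
Qed.
Canonical ones_perm_morphism := Morphism ones_permM.

End OnesPerm.
End ZeroOneMatrices.

(* Main.v *)
Require Import Defs.
From HB Require Import structures.
From mathcomp Require Import all_boot all_order all_algebra all_fingroup.
From mathcomp Require Import mxtens.
From mathcomp Require boolp classical_sets.

(** The proof computes both multiplicities by characters, and it works for
arbitrary modules S1, S2, S over the symmetric groups in place of the Specht
modules ([mult_tens_cell_simple]).

Multiplicities as traces. The trace of an operator is additive along a
composition series. So if a fixed combination of traces takes the value 1 on the
simple modules isomorphic to L and 0 on the other simple modules, it computes
[V : L] for every V ([mult_trace]). For a finite group and a simple S such a
combination is the scalar product with the character of S ([mult_group]), by
Schur's lemma.

For I_n^* and L = k[L_tau] (x) S, multiplicities are pulled back from the
symmetric group S_tau. Let e_f be the idempotent of I_n^* attached to a set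
partition, given as the kernel of a map f, and let e_tau be the one of tau. The
operator E ([Eop]) is the product of the 1 - e_f, over the f whose kernel does
not refine tau, and of e_tau: it projects V onto the vectors which e_tau fixes
and which are killed by all the elements of I_n^* that identify two parts of
tau. The image E V is a module over S_tau ([E_rep]). Every x of I_n^*
satisfies E x E = s E for some s of S_tau, or E x E = 0 ([Eop_act_Eop]).
Hence, for V simple, E V is simple or zero ([E_rep_irreducible]), and for S
simple it is isomorphic to S exactly when V is isomorphic to k[L_tau] (x) S
([isomorphic_E_repP]). The multiplicity of k[L_tau] (x) S in V is therefore the
scalar product of the character of S with s |-> tr(s E | V)
([mult_cell_simple]). If S is not simple, neither is k[L_tau] (x) S
([irreducible_coefficients]), and both sides of the formula are zero.

Counting. The elements of L_rho are the surjections from {0, ..., n-1} to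
{0, ..., k-1} ([img]): x sends the surjection f to f' if f i = f' j whenever x
relates i to j, and to zero if there is no such f'. On k[L_rho] (x) k[L_sigma]
the operator E keeps the pairs of surjections whose joint kernel is tau and kills
the other pairs ([Eop_bas]). Such a pair is the same thing as an injective
labelling of the entries of a 0/1-matrix M by {0, ..., m-1}, with all rows and
columns of M non-zero. So tr(s E) on the tensor product of the two cell modules,
twisted by h in S_k x S_l, is the number of the labellings on which the relabelling by s
and the permutation of rows and columns by h cancel ([lftr_cells_count],
[card_fixed_cells], [card_surj_labellings]). The labellings of a fixed M form a
torsor under S_m, and the same numbers give the character of the module induced
from the stabilizer of M ([chr_ind]). The sum over all M becomes the sum over
representatives of the orbits, because the terms are constant on orbits and an
orbit has k! l! / |H_M| elements ([sum_stab_sum]). *)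

Set Implicit Arguments.
Unset Strict Implicit.
Unset Printing Implicit Defensive.

Import GRing.Theory VectorInternalTheory passmx.
Local Open Scope ring_scope.

(* The names act and ract also denote notions of group actions. *)
Local Notation act := Defs.act.
Local Notation ract := Defs.ract.

(** * Traces of endomorphisms *)

Section Trace.
Variable F : fieldType.
Implicit Types U V W : vectType F.

(** Unlike [lfunE], this needs no structure of linear map on f; it serves for
the linear maps that are built inside proofs. *)
Lemma linfunE V W (f : V -> W) : linear f -> linfun f =1 f.
Proof.
move=> lf; pose ff : {linear V -> W} := HB.pack f (GRing.isLinear.Build F V W *:%R f lf).
exact: (lfunE ff).
Qed.

Lemma linear_at0 V W (f : V -> W) : linear f -> f 0 = 0.
Proof. by move=> lf; rewrite -(linfunE lf) linear0. Qed.

Lemma linear_sumE V W (f : V -> W) (I : finType) (c : I -> F) (v : I -> V) :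
  linear f -> f (\sum_i c i *: v i) = \sum_i c i *: f (v i).
Proof.
move=> lf; rewrite -(linfunE lf) linear_sum; apply: eq_bigr => i _.
by rewrite linearZ /= linfunE.
Qed.

(** A frame is a family of vectors with coordinate functions, independent of the
basis chosen by the structure of vector space; traces can be computed in any of
them ([lftrE]). *)
Definition frame V (I : finType) (v : I -> V) (phi : I -> V -> F) : Prop :=
  (forall i, scalar (phi i)) /\ (forall w, w = \sum_i phi i w *: v i).

Lemma scalar_at0 V (phi : V -> F) : scalar phi -> phi 0 = 0.
Proof. by move=> lphi; have := lphi (-1) 0 0; rewrite scaler0 addr0 mulN1r addNr. Qed.

Lemma scalar_sum V (phi : V -> F) (I : finType) (c : I -> F) (v : I -> V) :
  scalar phi -> phi (\sum_i c i *: v i) = \sum_i c i * phi (v i).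
Proof.
move=> lphi; have phi0 := scalar_at0 lphi.
by elim/big_rec2: _ => // i y1 y2 _ <-; rewrite lphi.
Qed.

(** Both sides expand to the same double sum of products of matrix entries. It
gives at once the independence of the trace from the frame and tr(fg) = tr(gf).
*)
Lemma frame_mulC V W (I J : finType) (v : I -> V) phi (w : J -> W) psi
    (f : 'Hom(V, W)) (g : 'Hom(W, V)) :
    frame v phi -> frame w psi ->
  \sum_i phi i (g (f (v i))) = \sum_j psi j (f (g (w j))).
Proof.
move=> [lphi vE] [lpsi wE].
transitivity (\sum_i \sum_j psi j (f (v i)) * phi i (g (w j))).
  apply: eq_bigr => i _; rewrite {1}(wE (f (v i))) linear_sum /=.
  by rewrite -scalar_sum //; congr (phi i _); apply: eq_bigr => j _; rewrite linearZ.
rewrite exchange_big; apply: eq_bigr => j _; rewrite {2}(vE (g (w j))) linear_sum /=.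
rewrite (eq_bigr (fun i => phi i (g (w j)) *: f (v i))); last first.
  by move=> i _; rewrite linearZ.
by rewrite scalar_sum //; apply: eq_bigr => i _; rewrite mulrC.
Qed.

Lemma frame_vbasis V :
  frame (fun i : 'I_(\dim {:V}) => (vbasis {:V})`_i) (fun i => coord (vbasis {:V}) i).
Proof.
split=> [i a u w | w]; first by rewrite linearP.
exact/coord_vbasis/memvf.
Qed.

Definition lftr V (f : 'End(V)) : F :=
  \sum_i coord (vbasis {:V}) i (f (vbasis {:V})`_i).

Lemma lftrE V (I : finType) (v : I -> V) phi (f : 'End(V)) :
  frame v phi -> lftr f = \sum_i phi i (f (v i)).
Proof.
move=> fr; have := frame_mulC f \1%VF (frame_vbasis V) fr.
under eq_bigr do rewrite id_lfunE.
by under [X in _ = X -> _]eq_bigr do rewrite id_lfunE.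
Qed.

Lemma lftr_comp V W (f : 'Hom(V, W)) (g : 'Hom(W, V)) :
  lftr (g \o f)%VF = lftr (f \o g)%VF.
Proof.
have := frame_mulC f g (frame_vbasis V) (frame_vbasis W); rewrite /lftr.
under eq_bigr do rewrite -comp_lfunE.
by under [X in _ = X -> _]eq_bigr do rewrite -comp_lfunE.
Qed.

Lemma lftr_linear V : scalar (@lftr V).
Proof.
move=> a f g; rewrite /lftr mulr_sumr -big_split; apply: eq_bigr => i _ /=.
by rewrite add_lfunE scale_lfunE linearP.
Qed.
HB.instance Definition _ V :=
  GRing.isLinear.Build F 'End(V) F *%R (@lftr V) (@lftr_linear V).

Lemma lftr1 V : lftr (\1%VF : 'End(V)) = (\dim {:V})%:R.
Proof.
rewrite /lftr; under eq_bigr => i _.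
  rewrite id_lfunE coord_free ?eqxx; last exact/basis_free/vbasisP.
  over.
by rewrite sumr_const card_ord.
Qed.

Lemma lftr_conj V W (f : 'End(V)) (g : 'End(W)) (h : 'Hom(V, W)) (k : 'Hom(W, V)) :
  (k \o h = \1)%VF -> (h \o f = g \o h)%VF -> (h \o k = \1)%VF -> lftr f = lftr g.
Proof.
move=> kh hf hk.
by rewrite -[f]comp_lfun1l -kh -comp_lfunA hf lftr_comp -comp_lfunA hk comp_lfun1r.
Qed.

(** If pi is a projection with the same kernel as q, then f' has the trace of f
pi. Indeed pi kills v - i (q v), so that pi = pi i q, and the trace is cyclic.
*)
Lemma lftr_quot V (Q : vectType F) (q : 'Hom(V, Q)) (i : 'Hom(Q, V))
    (pi f : 'End(V)) (f' : 'End(Q)) :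
    (q \o i = \1)%VF -> (q \o pi = q)%VF -> (forall v, q v = 0 -> pi v = 0) ->
    (q \o f = f' \o q)%VF ->
  lftr f' = lftr (f \o pi)%VF.
Proof.
move=> qi qpi kpi qf.
have piiq : (pi \o i \o q = pi)%VF.
  apply/lfunP=> v; rewrite !comp_lfunE; apply/eqP; rewrite -subr_eq0 -linearB.
  by apply/eqP/kpi; rewrite linearB /= -[q (i _)]comp_lfunE qi id_lfunE subrr.
have -> : (f \o pi = (f \o pi \o i) \o q)%VF by rewrite -!comp_lfunA [(pi \o _)%VF]comp_lfunA piiq.
rewrite lftr_comp !comp_lfunA qf -[(_ \o q \o pi)%VF]comp_lfunA qpi -comp_lfunA qi.
by rewrite comp_lfun1r.
Qed.

(** On a subspace stable under f this is the trace of the restriction of f, with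
no need of the restriction as an endomorphism of a smaller space. *)
Definition trace_on V (U : {vspace V}) (f : 'End(V)) := lftr (f \o projv U)%VF.

Lemma lfun_section V (U : {vspace V}) (Q : vectType F) (p : 'Hom(V, Q)) :
  (p @: U)%VS = fullv -> exists i : 'Hom(Q, V), (forall x, i x \in U) /\ (p \o i = \1)%VF.
Proof.
(* The pseudo-inverse of a surjective map is a right inverse. *)
move=> pU; exists (projv U \o (p \o projv U)^-1)%VF; split.
  by move=> x; rewrite comp_lfunE memv_proj.
apply/lfunP=> x; rewrite comp_lfunA comp_lfunE limg_lfunVK ?id_lfunE //.
by rewrite limg_comp limg_proj pU memvf.
Qed.

(** Additivity of the trace, for a subquotient U / W presented by a map p on the
ambient space. With i a section of p, the projection onto U is the sum of a = (1
- i p) projv U, which takes its values in W and fixes W, and of i p projv U; the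
two traces are then moved to W and to Q by cyclicity. *)
Lemma trace_on_step V (W U : {vspace V}) (Q : vectType F) (p : 'Hom(V, Q))
    (f : 'End(V)) (f' : 'End(Q)) :
    (p @: U)%VS = fullv -> (U :&: lker p)%VS = W ->
    (forall u, u \in U -> f u \in U) -> (forall u, u \in W -> f u \in W) ->
    (forall u, u \in U -> p (f u) = f' (p u)) ->
  trace_on U f = trace_on W f + lftr f'.
Proof.
move=> pU kerp fU fW pf; have [i [iU pi]] := lfun_section pU.
have piE x : p (i x) = x by rewrite -comp_lfunE pi id_lfunE.
pose a := (projv U - (i \o (p \o projv U)))%VF.
have aE v : a v = projv U v - i (p (projv U v)).
  by rewrite add_lfunE opp_lfunE !comp_lfunE.
have aW v : a v \in W.
  by rewrite -kerp memv_cap memv_ker aE linearB /= piE subrr eqxx rpredB ?memv_proj.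
have WU w : w \in W -> w \in U /\ p w = 0.
  by rewrite -kerp memv_cap memv_ker => /andP[? /eqP].
have aid w : w \in W -> a w = w.
  by move=> /WU[wU pw]; rewrite aE projv_id // pw linear0 subr0.
rewrite /trace_on.
have -> : (f \o projv U = ((f \o projv W) \o a) + ((f \o i) \o (p \o projv U)))%VF.
  apply/lfunP=> v; rewrite add_lfunE !comp_lfunE (projv_id (aW v)) aE linearB /=.
  by rewrite subrK.
rewrite linearD /=; congr (_ + _); rewrite lftr_comp; congr (lftr _).
  by apply/lfunP=> v; rewrite !comp_lfunE aid // fW // memv_proj.
by apply/lfunP=> x; rewrite !comp_lfunE projv_id ?fU // pf ?piE.
Qed.

Lemma trace_on0 V f : trace_on (0 : {vspace V})%VS f = 0.
Proof.
rewrite /trace_on (_ : _ \o _ = 0)%VF ?linear0 //; apply/lfunP=> v.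
have /eqP pv0 : projv (0 : {vspace V}) v == 0 by rewrite -memv0 memv_proj.
by rewrite comp_lfunE pv0 linear0 zero_lfunE.
Qed.

Lemma trace_onf V f : trace_on {:V} f = lftr f.
Proof.
by congr (lftr _); apply/lfunP=> v; rewrite comp_lfunE projv_id ?memvf.
Qed.
End Trace.

(** * Multiplicities as combinations of traces *)

Section Multiplicities.
Variables (F : fieldType) (A : monoidType).
Implicit Types V L Q : rep F A.

Definition chr V (x : A) : F := lftr (act V x).

(** A simple module is a composition step from 0 to the whole space. *)
Definition irreducible_rep V : Prop := simple_step (0 : {vspace V})%VS fullv.

(** An isomorphism is the case W = 0, U = V of an isomorphism onto a composition
factor. *)
Definition isomorphic V L : Prop := factor_iso L (0 : {vspace V})%VS fullv.

Lemma irreducible_repP V :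
  irreducible_rep V <->
  (exists v : V, v != 0) /\
  (forall X : {vspace V}, stable X -> forall v, v \in X -> v != 0 -> X = fullv).
Proof.
split=> [[_ _ [_ n0] s] | [[v v0] s]].
  split; first by exists (vpick {:V}); rewrite vpick0 eq_sym.
  move=> X sX v vX v0; case: (s X) => // [||X0]; rewrite ?sub0v ?subvf //.
  by move: vX; rewrite X0 memv0 (negPf v0).
split=> [x|x||X sX _ _].
- by rewrite limg0.
- exact: subvf.
- split; first exact: sub0v.
  by apply: contraNneq v0 => e; rewrite -memv0 e memvf.
- have [->|X0] := eqVneq X 0%VS; [by left|right].
  by apply: s (memv_pick X) _ => //; rewrite vpick0.
Qed.

Lemma isomorphicP V L :
  isomorphic V L <-> exists (f : 'Hom(V, L)) (g : 'Hom(L, V)),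
    [/\ (g \o f = \1)%VF, (f \o g = \1)%VF
      & forall x v, f (act V x v) = act L x (f v)].
Proof.
split=> [[f [fV kf fe]] | [f [g [gf fg fe]]]].
  have kf0 : lker f == 0%VS by rewrite -kf capfv.
  exists f, f^-1%VF; split=> [||x v]; last by rewrite fe ?memvf.
    exact: lker0_compVf.
  by apply/lfunP=> v; rewrite comp_lfunE limg_lfunVK ?id_lfunE // fV memvf.
exists f; split=> [||x v _]; last exact: fe.
  apply/eqP; rewrite eqEsubv subvf; apply/subvP=> u _.
  by rewrite -[u]id_lfunE -fg comp_lfunE memv_img ?memvf.
rewrite capfv; apply/eqP/lker0P=> u v /(congr1 g).
by rewrite -!comp_lfunE gf !id_lfunE.
Qed.

Lemma isomorphic_sym V L : isomorphic V L -> isomorphic L V.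
Proof.
case/isomorphicP=> f [g [gf fg fe]]; apply/isomorphicP; exists g, f; split=> // x v.
rewrite -[v in LHS]id_lfunE -fg comp_lfunE -fe.
by rewrite -[g (f _)]comp_lfunE gf id_lfunE.
Qed.

Lemma isomorphic_chr V L x : isomorphic V L -> chr V x = chr L x.
Proof.
case/isomorphicP=> f [g [gf fg fe]]; apply: (@lftr_conj _ _ _ _ _ f g) => //.
by apply/lfunP=> v; rewrite !comp_lfunE fe.
Qed.

Lemma isomorphic_irreducible V L : isomorphic V L -> irreducible_rep V -> irreducible_rep L.
Proof.
case/isomorphicP=> f [g [gf fg fe]] /irreducible_repP[[v v0] s].
have gK : cancel f g by move=> w; rewrite -comp_lfunE gf id_lfunE.
have fK : cancel g f by move=> w; rewrite -comp_lfunE fg id_lfunE.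
apply/irreducible_repP; split.
  by exists (f v); apply: contraNneq v0 => fv; rewrite -(gK v) fv linear0.
move=> X sX w wX w0; suff e : (f @^-1: X)%VS = fullv.
  apply/eqP; rewrite eqEsubv subvf; apply/subvP=> u _.
  by rewrite -(fK u) memv_preim e memvf.
apply: (s _ _ (g w)); last by apply: contraNneq w0 => gw; rewrite -(fK w) gw linear0.
- move=> x; apply/subvP=> _ /memv_imgP[u + ->]; rewrite -!memv_preim fe => uX.
  exact: stable_act.
- by rewrite -memv_preim fK.
Qed.

(** The factor U / W of a composition series is realised as a module Q of its
own: the image of U in V / W. *)
Lemma simple_step_factor V (W U : {vspace V}) : simple_step W U ->
  exists (Q : rep F A) (p : 'Hom(V, Q)),
    [/\ (p @: U)%VS = fullv, (U :&: lker p)%VS = W,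
        forall (x : A) u, u \in U -> p (act V x u) = act Q x (p u)
      & irreducible_rep Q].
Proof.
case=> sW sU [WU nWU] mX.
pose q : 'Hom(V, quot_rep sW) := quot_proj W.
have qE x v : q (act V x v) = act (quot_rep sW) x (q v) by rewrite [RHS]quot_actE.
have sqU : stable (q @: U)%VS.
  move=> x; apply/subvP=> _ /memv_imgP[_ /memv_imgP[u uU ->] ->].
  by rewrite -qE memv_img // stable_act.
pose Q := sub_rep sqU.
pose p : 'Hom(V, Q) := (linfun (vsproj (q @: U)%VS) \o q)%VF.
have pq u : u \in U -> vsval (p u) = q u.
  by move=> uU; rewrite comp_lfunE lfunE /= vsprojK // memv_img.
have pU : (p @: U)%VS = fullv.
  apply/eqP; rewrite eqEsubv subvf; apply/subvP=> z _.
  have /memv_imgP[u uU e] := subvsP z.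
  by rewrite (_ : z = p u) ?memv_img //; apply/subvs_inj; rewrite pq.
have kp : (U :&: lker p)%VS = W.
  apply/vspaceP=> u; rewrite memv_cap memv_ker.
  have [uU | nuU] := boolP (u \in U); last first.
    by symmetry; apply: contraNF nuU => /(subvP WU).
  by rewrite -(inj_eq subvs_inj) pq // raddf0 quot_proj0.
have pE (x : A) u : u \in U -> p (act V x u) = act Q x (p u).
  move=> uU; apply: subvs_inj; rewrite pq ?stable_act // qE.
  by rewrite [RHS](sub_actE sqU) pq.
exists Q, p; split=> //; apply/irreducible_repP; split.
  have /subvPn[u uU nuW] : ~~ (U <= W)%VS by rewrite eqEsubv WU in nWU.
  exists (p u); apply: contra nuW => pu0.
  by rewrite -kp memv_cap uU memv_ker.
move=> X sX v vX v0; pose X' := (U :&: p @^-1: X)%VS.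
have pX' : (p @: X')%VS = X.
  apply/vspaceP=> z; apply/memv_imgP/idP=> [[u /memv_capP[_ +] ->] | zX].
    by rewrite -memv_preim.
  have /memv_imgP[u uU zE] : z \in (p @: U)%VS by rewrite pU memvf.
  by exists u => //; rewrite memv_cap uU -memv_preim -zE.
have [||| X'W | X'U] := mX X'.
- move=> x; apply/subvP=> _ /memv_imgP[u + ->].
  rewrite !memv_cap -!memv_preim => /andP[uU uX].
  by rewrite (stable_act sU) // pE //; apply: (stable_act sX).
- by rewrite -kp capvS // -lpreim0 lpreimS ?sub0v.
- exact: capvSl.
- case/eqP: v0; apply/eqP; rewrite -memv0.
  suff <- : X = 0%VS by [].
  by apply/eqP; rewrite -pX' X'W -lkerE -kp capvSr.
- by rewrite -pX' X'U.
Qed.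

(** Being isomorphic to the subquotient U / W does not depend on how it is
presented. *)
Lemma factor_isoE V L Q (W U : {vspace V}) (p : 'Hom(V, Q)) :
    (p @: U)%VS = fullv -> (U :&: lker p)%VS = W -> stable U ->
    (forall (x : A) u, u \in U -> p (act V x u) = act Q x (p u)) ->
  factor_iso L W U <-> isomorphic Q L.
Proof.
move=> pU kp sU pE.
have [i [iU pi]] := lfun_section pU.
have piE z : p (i z) = z by rewrite -comp_lfunE pi id_lfunE.
have dU u : u \in U -> u - i (p u) \in W.
  by move=> uU; rewrite -kp memv_cap memv_ker linearB /= piE subrr eqxx rpredB.
split=> [[f [fU kf fE]] | [f [fU kf fE]]].
  have fW u : u \in W -> f u = 0.
    by rewrite -kf memv_cap memv_ker => /andP[_ /eqP].
  have fip u : u \in U -> f (i (p u)) = f u.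
    by move=> uU; apply/eqP; rewrite eq_sym -subr_eq0 -linearB /= fW ?dU.
  exists (f \o i)%VF; split=> [||x z _].
  - apply/eqP; rewrite eqEsubv subvf; apply/subvP=> w _.
    have /memv_imgP[u uU ->] : w \in (f @: U)%VS by rewrite fU memvf.
    by rewrite -fip // -comp_lfunE memv_img ?memvf.
  - apply/eqP; rewrite capfv -subv0; apply/subvP=> z.
    rewrite memv_ker comp_lfunE memv0 => fz.
    have : i z \in W by rewrite -kf memv_cap iU memv_ker.
    by rewrite -kp memv_cap memv_ker piE => /andP[].
  - rewrite !comp_lfunE -fE // -[RHS]fip ?stable_act //.
    by rewrite pE // piE.
exists (f \o p)%VF; split=> [||x u uU].
- by rewrite limg_comp pU.
- rewrite -kp; apply/vspaceP=> u; rewrite !memv_cap !memv_ker comp_lfunE.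
  congr (_ && _); apply/eqP/eqP=> [fpu | ->]; last by rewrite linear0.
  by apply/eqP; rewrite -memv0 -kf memv_cap memvf memv_ker fpu eqxx.
- by rewrite !comp_lfunE pE // fE ?memvf.
Qed.

(** Above a proper stable subspace, a stable subspace of minimal dimension among
the strictly larger ones is a simple step; the dimension of what remains
decreases. *)
Lemma composition_series_from V (W : {vspace V}) : stable W ->
  exists (t : nat) (U : nat -> {vspace V}),
    [/\ U 0%N = W, U t = fullv & forall i, (i < t)%N -> simple_step (U i) (U i.+1)].
Proof.
have [d] := ubnP (\dim {:V} - \dim W)%N.
elim: d W => // d IHd W ltd sW.
have [-> | nWf] := eqVneq W fullv; first by exists 0%N, (fun=> fullv); split.
pose P (e : nat) := boolp.asbool (exists X : {vspace V},
  [/\ stable X, (W <= X)%VS, W != X & \dim X = e]).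
have exP : exists e, P e.
  exists (\dim {:V}); apply/boolp.asboolP; exists fullv; split; rewrite ?subvf //.
  by move=> x; apply: subvf.
case: (ex_minnP exP) => e /boolp.asboolP[X [sX WX nWX <-]] minX.
have dWX : (\dim W < \dim X)%N.
  rewrite ltnNge; apply: contra nWX => le.
  by rewrite eqEdim WX.
have [|t [U [U0 Ut stepU]]] := IHd X _ sX.
  rewrite -ltnS; apply: leq_trans (ltd); rewrite ltnS ltn_sub2l //.
  exact: leq_trans (dimvS (subvf X)).
exists t.+1, (fun i => if i is j.+1 then U j else W); split=> // -[_ | i] /=; last first.
  by rewrite ltnS => /stepU.
rewrite U0; split=> // Y sY WY YX; have [->|nWY] := eqVneq W Y; [by left | right].
apply/eqP; rewrite eqEdim YX minX //; apply/boolp.asboolP; exists Y; split=> //.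
Qed.

Lemma multP V L : mult_spec V L (mult V L).
Proof.
apply: classical_sets.xgetPex; have s0 : stable (0 : {vspace V})%VS.
  by move=> x; rewrite limg0.
have [t [U [U0 Ut stepU]]] := composition_series_from s0.
by exists #|[set i : 'I_t | boolp.asbool (factor_iso L (U i) (U i.+1))]|, t, U.
Qed.

Lemma mult_not_irreducible V L : ~ irreducible_rep L -> mult V L = 0%N.
Proof.
move=> nL; have [t [U [_ _ stepU ->]]] := multP V L.
apply: eq_card0 => i; rewrite inE; apply/negP=> /boolp.asboolP fi.
have sU := stepU i (ltn_ord i).
have [Q [p [pU kp pE irrQ]]] := simple_step_factor sU.
have [_ stU _ _] := sU; apply: nL; apply: isomorphic_irreducible irrQ.
by have [+ _] := factor_isoE L pU kp stU pE; apply.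
Qed.

(** The trace telescopes along a composition series, so a combination of traces
that detects L among the simple modules counts the factors isomorphic to L. In
particular the count is the same in all composition series. *)
Lemma mult_trace (I : finType) (c : I -> F) (a : I -> A) L :
    (forall Q, irreducible_rep Q ->
       \sum_i c i * chr Q (a i) = (boolp.asbool (isomorphic Q L))%:R) ->
  forall V, (mult V L)%:R = \sum_i c i * chr V (a i).
Proof.
move=> cQ V; have [t [U [U0 Ut stepU ->]]] := multP V L.
pose th (W : {vspace V}) := \sum_i c i * trace_on W (act V (a i)).
have thS i : (i < t)%N ->
    th (U i.+1) = th (U i) + (boolp.asbool (factor_iso L (U i) (U i.+1)))%:R.
  move=> /stepU st; have [Q [p [pU kp pE irrQ]]] := simple_step_factor st.
  have [sW sU _ _] := st.
  rewrite (boolp.asbool_equiv_eq (factor_isoE L pU kp sU pE)) -cQ // -big_split /=.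
  apply: eq_bigr => j _; rewrite -mulrDr; congr (_ * _).
  apply: trace_on_step pU kp _ _ _ => u uW; [exact: stable_act | exact: stable_act|].
  exact: pE.
have -> : \sum_i c i * chr V (a i) = th (U t).
  by rewrite Ut; apply: eq_bigr => i _; rewrite trace_onf.
rewrite -sum1dep_card big_mkcond natr_sum /=.
have {thS} thE s : (s <= t)%N ->
    th (U s) = \sum_(i < s) (boolp.asbool (factor_iso L (U i) (U i.+1)))%:R.
  elim: s => [_|s IHs lst].
    by rewrite big_ord0 U0 /th big1 // => i _; rewrite trace_on0 mulr0.
  by rewrite big_ord_recr /= thS // IHs // ltnW.
by rewrite thE //; apply: eq_bigr => i _; case: ifP.
Qed.

End Multiplicities.

(** * Orthogonality of characters *)

Section Schur.
Variables (F : fieldType) (A : monoidType).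
Implicit Types V W : rep F A.

Lemma schur_iso V W (f : 'Hom(V, W)) : irreducible_rep V -> irreducible_rep W ->
  (forall x v, f (act V x v) = act W x (f v)) -> f != 0 -> isomorphic V W.
Proof.
move=> /irreducible_repP[_ sV] /irreducible_repP[_ sW] fE f0.
have [u fu0] : exists u, f u != 0.
  by have /lfunPn[u] := f0; rewrite zero_lfunE; exists u.
exists f; split=> [||x v _]; last exact: fE.
  apply: (sW _ _ (f u)); rewrite ?memv_img ?memvf // => x.
  by apply/subvP=> _ /memv_imgP[_ /memv_imgP[v _ ->] ->]; rewrite -fE memv_img ?memvf.
rewrite capfv; apply/eqP; rewrite -vpick0; apply: contraNT fu0 => v0.
rewrite -memv_ker (sV _ _ _ (memv_pick (lker f)) v0) ?memvf // => x.
apply/subvP=> _ /memv_imgP[v + ->]; rewrite !memv_ker fE => /eqP->.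
by rewrite linear0.
Qed.
End Schur.

(** The eigenspace of an eigenvalue of f is stable and non-zero, hence
everything. *)
Lemma schur_scalar (F : closedFieldType) (A : monoidType) (V : rep F A)
    (f : 'End(V)) : irreducible_rep V ->
  (forall x v, f (act V x v) = act V x (f v)) -> exists c, f = c *: \1%VF.
Proof.
move=> /irreducible_repP[[v0 nv0] sV] fE.
pose e := vbasis {:V}; have be : basis_of {:V} e := vbasisP _.
have [c rc] : exists c, root (char_poly (mxof e e f)) c.
  apply/closed_rootP; rewrite size_char_poly eqSS dimv_eq0.
  by apply: contraNneq nv0 => V0; rewrite -memv0 -V0 memvf.
have : leigenspace f c != 0%VS.
  by rewrite (leigenspaceE be) vsof_eq0 // -eigenvalue_root_char in rc *.
rewrite -vpick0 => n0.
have fullc : leigenspace f c = fullv.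
  apply: sV (memv_pick _) n0 => x; apply/subvP=> _ /memv_imgP[v + ->].
  rewrite !memv_ker !(add_lfunE, opp_lfunE, scale_lfunE, id_lfunE) fE.
  by rewrite !subr_eq0 => /eqP->; rewrite linearZ.
exists c; apply/lfunP=> v; apply/eqP; rewrite -subr_eq0.
have : v \in leigenspace f c by rewrite fullc memvf.
by rewrite memv_ker !(add_lfunE, opp_lfunE).
Qed.

Section GroupReps.
Variables (F : fieldType) (gT : finGroupType).
Implicit Types V W : group_rep F gT.

Lemma group_act1 V : act V (1%g : gT) = \1%VF.
Proof. exact: (act_one V). Qed.

(** The order is reversed because a [group_rep] is a module over the opposite
group. *)
Lemma group_actM V (g h : gT) : act V (g * h)%g = (act V h \o act V g)%VF.
Proof. exact: (act_mul V h g). Qed.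

Definition hom_avg V W (T : 'Hom(V, W)) : 'Hom(V, W) :=
  \sum_(g : gT) (act W g \o T \o act V g^-1%g)%VF.

Lemma hom_avgE V W (T : 'Hom(V, W)) (x : gT) v :
  hom_avg T (act V x v) = act W x (hom_avg T v).
Proof.
rewrite !sum_lfunE linear_sum /= (reindex_inj (mulIg x)) /=.
apply: eq_bigr => g _; rewrite !comp_lfunE group_actM comp_lfunE; congr (act W x (act W g (T _))).
by rewrite -comp_lfunE -group_actM invMg mulgA mulgV mul1g.
Qed.

Definition rank1 (V W : vectType F) (i : 'I_(\dim {:V})) (w : W) : 'Hom(V, W) :=
  linfun (fun v => coord (vbasis {:V}) i v *: w).

Lemma rank1E (V W : vectType F) i (w : W) (v : V) :
  rank1 i w v = coord (vbasis {:V}) i v *: w.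
Proof.
have lin : linear (fun v : V => coord (vbasis {:V}) i v *: w).
  by move=> a u1 u2; rewrite linearP scalerDl scalerA.
exact: linfunE.
Qed.

(** A product of two traces is a sum over matrix units T, so the scalar product
of two characters is read off from the averages of the matrix units. *)
Lemma sum_chr_hom_avg V W :
  \sum_(g : gT) chr V g^-1%g * chr W g =
  \sum_i \sum_j coord (vbasis {:W}) j
    (hom_avg (rank1 i (vbasis {:W})`_j) (vbasis {:V})`_i).
Proof.
rewrite (eq_bigr (fun g => \sum_i \sum_j coord (vbasis {:W}) j
   ((act W g \o rank1 i (vbasis {:W})`_j \o act V g^-1%g)%VF (vbasis {:V})`_i))).
  rewrite exchange_big; apply: eq_bigr => i _; rewrite exchange_big.
  by apply: eq_bigr => j _; rewrite sum_lfunE linear_sum.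
move=> g _; rewrite /chr /lftr mulr_suml; apply: eq_bigr => i _.
by rewrite mulr_sumr; apply: eq_bigr => j _; rewrite !comp_lfunE rank1E !linearZ.
Qed.
End GroupReps.

(** If V and W are not isomorphic, all the averages vanish. Otherwise W can be
replaced by V, each average is a scalar c, and c dim V = |G| tr T determines it.
*)
Lemma chr_orthogonality (F : closedFieldType) (charF0 : [pchar F] =i pred0)
    (gT : finGroupType) (V W : group_rep F gT) :
    irreducible_rep V -> irreducible_rep W ->
  \sum_(g : gT) chr V g^-1%g * chr W g =
  #|gT|%:R * (boolp.asbool (isomorphic W V))%:R.
Proof.
move=> irrV irrW; case: boolp.asboolP => [isoWV | niso]; last first.
  rewrite mulr0 sum_chr_hom_avg big1 // => i _; rewrite big1 // => j _.
  case: (eqVneq (hom_avg (rank1 i (vbasis {:W})`_j)) 0) => [-> | n0].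
    by rewrite zero_lfunE linear0.
  by case: niso; apply/isomorphic_sym/(schur_iso irrV irrW _ n0)/hom_avgE.
rewrite mulr1 (eq_bigr (fun g => chr V g^-1%g * chr V g)); last first.
  by move=> g _; rewrite (isomorphic_chr _ isoWV).
have dF : (\dim {:V})%:R != 0 :> F.
  have /irreducible_repP[[v v0] _] := irrV.
  rewrite ((pcharf0P F).1 charF0) dimv_eq0.
  by apply: contraNneq v0 => V0; rewrite -memv0 -V0 memvf.
apply: (mulfI dF); rewrite sum_chr_hom_avg mulr_sumr.
have fr : free (vbasis {:V}) := basis_free (vbasisP _).
rewrite -[(\dim {:V})%:R in RHS]mulr1 -mulrA mul1r -[in RHS](card_ord (\dim {:V})).
rewrite [RHS]mulr_natl -sumr_const; apply: eq_bigr => i _.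
rewrite mulr_sumr (bigD1 i) //= big1 => [|j ji].
  rewrite addr0.
  have [c cE] := schur_scalar irrV (hom_avgE (rank1 i (vbasis {:V})`_i)).
  have : lftr (hom_avg (rank1 i (vbasis {:V})`_i)) = #|gT|%:R.
    rewrite /hom_avg linear_sum /= (eq_bigr (fun=> 1)); first by rewrite sumr_const.
    move=> g _; rewrite lftr_comp comp_lfunA -group_actM mulgV group_act1 comp_lfun1l.
    rewrite /lftr (bigD1 i) //= big1 => [|j ji].
      by rewrite rank1E linearZ /= !coord_free // eqxx mulr1 addr0.
    by rewrite rank1E linearZ /= !coord_free // ?(eq_sym i j) (negPf ji) ?mulr0 ?mul0r.
  rewrite {}cE linearZ /= lftr1 => <-; rewrite scale_lfunE id_lfunE linearZ /=.
  by rewrite coord_free // eqxx mulr1 mulrC.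
have [c ->] := schur_scalar irrV (hom_avgE (rank1 i (vbasis {:V})`_j)).
by rewrite scale_lfunE id_lfunE linearZ /= coord_free // ?(eq_sym i j) (negPf ji) !mulr0.
Qed.

(** * Traces on tensor products *)

Section TensorSpaces.
Variable F : fieldType.
Implicit Types U V W : vectType F.

Definition tens_coef U V (w : tensV U V) (a : 'I_(dim U)) (b : 'I_(dim V)) : F :=
  (w : 'rV_(dim U * dim V)) 0 (mxtens_index (a, b)).

Lemma tens_coefD U V (w w' : tensV U V) a b k :
  tens_coef (k *: w + w') a b = k * tens_coef w a b + tens_coef w' a b.
Proof. by rewrite /tens_coef !mxE. Qed.

Lemma pure_tensE U V (u : U) (v : V) a b :
  tens_coef (pure_tens u v) a b = v2r u 0 a * v2r v 0 b.
Proof.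
rewrite /tens_coef /pure_tens -[in RHS](tensmxE (v2r u) (v2r v)).
by congr (fun_of_matrix _ _ _); apply: val_inj; case: (mxtens_index _) => [[|?] ?].
Qed.

Lemma tens_coefP U V (w w' : tensV U V) :
  (forall a b, tens_coef w a b = tens_coef w' a b) -> w = w'.
Proof. by move=> e; apply/rowP=> i; case: (mxtens_indexP i) => a b; apply: e. Qed.

Lemma pure_tens_linearl U V (v : V) : linear (fun u : U => pure_tens u v).
Proof.
move=> k u u'; apply: tens_coefP => a b.
by rewrite tens_coefD !pure_tensE linearP !mxE mulrDl mulrA.
Qed.

Lemma pure_tens_linearr U V (u : U) : linear (fun v : V => pure_tens u v).
Proof.
move=> k v v'; apply: tens_coefP => a b.
by rewrite tens_coefD !pure_tensE linearP !mxE mulrDr mulrCA.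
Qed.

Lemma pure_tens0l U V (v : V) : pure_tens (0 : U) v = 0.
Proof. exact: linear_at0 (pure_tens_linearl v). Qed.

Lemma pure_tens0r U V (u : U) : pure_tens u (0 : V) = 0.
Proof. exact: linear_at0 (pure_tens_linearr u). Qed.

Local Notation e_ a := (r2v (delta_mx 0 a)).

Lemma sum_e U (u : U) : u = \sum_a v2r u 0 a *: e_ a.
Proof.
rewrite -[LHS]v2rK {1}[v2r u]row_sum_delta linear_sum.
by apply: eq_bigr => a _; rewrite linearZ.
Qed.

Lemma tens_sum U V (w : tensV U V) :
  w = \sum_a \sum_b tens_coef w a b *: pure_tens (e_ a : U) (e_ b : V).
Proof.
have cs (I : finType) (f : I -> tensV U V) a b :
    tens_coef (\sum_i f i) a b = \sum_i tens_coef (f i) a b.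
  by rewrite /tens_coef summxE.
apply: tens_coefP => a b; rewrite cs (bigD1 a) //= cs (bigD1 b) //=.
have cE a' b' : tens_coef (tens_coef w a' b' *: pure_tens (e_ a' : U) (e_ b' : V)) a b
    = tens_coef w a' b' * ((a == a')%:R * (b == b')%:R).
  by rewrite -[_ *: _]addr0 tens_coefD pure_tensE !r2vK !mxE /tens_coef mxE addr0.
rewrite cE !eqxx !mulr1 !big1 ?addr0 // => [a' na | b' nb].
  by rewrite cs big1 // => b' _; rewrite cE eq_sym (negPf na) mul0r mulr0.
by rewrite cE [b == _]eq_sym (negPf nb) !mulr0.
Qed.

Lemma tens_ext U V W (f g : 'Hom(tensV U V, W)) :
  (forall u v, f (pure_tens u v) = g (pure_tens u v)) -> f = g.
Proof.
move=> fg; apply/lfunP=> w; rewrite (tens_sum w) !linear_sum; apply: eq_bigr => a _.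
by rewrite !linear_sum; apply: eq_bigr => b _; rewrite !linearZ /= fg.
Qed.

(** The universal property of the tensor product, used to define linear maps by
their values on pure tensors. *)
Lemma tens_univ U V W (be : U -> V -> W) :
    (forall u, linear (be u)) -> (forall v, linear (be^~ v)) ->
  exists f : 'Hom(tensV U V, W), forall u v, f (pure_tens u v) = be u v.
Proof.
move=> lr ll.
pose h (w : tensV U V) := \sum_a \sum_b tens_coef w a b *: be (e_ a) (e_ b).
have lh : linear h.
  move=> k w w'; rewrite scaler_sumr -big_split; apply: eq_bigr => a _ /=.
  rewrite scaler_sumr -big_split; apply: eq_bigr => b _ /=.
  by rewrite tens_coefD scalerDl scalerA.
exists (linfun h) => u v; rewrite linfunE // /h [in RHS](sum_e u).
rewrite (linear_sumE _ _ (ll v)); apply: eq_bigr => a _.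
rewrite [in RHS](sum_e v) (linear_sumE _ _ (lr _)) scaler_sumr.
by apply: eq_bigr => b _; rewrite pure_tensE scalerA.
Qed.

(** Pure tensors of frames form a frame, with coordinates the products of
coordinates. *)
Lemma frame_tens U V (I J : finType) (u : I -> U) phi (v : J -> V) psi :
  frame u phi -> frame v psi ->
  exists2 th : I * J -> tensV U V -> F,
    (forall p a b, th p (pure_tens a b) = phi p.1 a * psi p.2 b)
    & frame (fun p => pure_tens (u p.1) (v p.2)) th.
Proof.
move=> [lphi uE] [lpsi vE].
have /boolp.choice[th thE] (p : I * J) : exists f : 'Hom(tensV U V, F^o),
    forall a b, f (pure_tens a b) = phi p.1 a * psi p.2 b.
  apply: tens_univ => [a k b b' | b k a a'].
    by rewrite lpsi mulrDr mulrCA.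
  by rewrite lphi mulrDl -mulrA.
exists (fun p w => th p w : F) => //; split=> [p k w w' | w]; first by rewrite linearP.
pose gf w' := \sum_p (th p w' : F) *: pure_tens (u p.1) (v p.2).
have lg : linear gf.
  move=> k w1 w2; rewrite /gf scaler_sumr -big_split; apply: eq_bigr => p _ /=.
  by rewrite linearP scalerDl scalerA.
suff e : \1%VF = linfun gf by rewrite -[LHS]id_lfunE e linfunE.
apply: tens_ext => a b; rewrite id_lfunE linfunE // /gf.
transitivity (\sum_i \sum_j (th (i, j) (pure_tens a b) : F) *: pure_tens (u i) (v j)).
  rewrite {1}(uE a) (linear_sumE _ _ (pure_tens_linearl b)).
  apply: eq_bigr => i _; rewrite {1}(vE b) (linear_sumE _ _ (pure_tens_linearr _)).
  by rewrite scaler_sumr; apply: eq_bigr => j _; rewrite thE scalerA.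
by rewrite pair_bigA; apply: eq_bigr => -[i j] _.
Qed.

Lemma lftr_tens U V (f : 'End(U)) (g : 'End(V)) :
  lftr (tens_lfun f g) = lftr f * lftr g.
Proof.
have [th thE fr] := frame_tens (frame_vbasis U) (frame_vbasis V).
rewrite (lftrE _ fr) [RHS]mulr_suml.
under [RHS]eq_bigr do rewrite mulr_sumr.
by rewrite pair_bigA; apply: eq_bigr => p _; rewrite tens_lfunE thE.
Qed.

Lemma frame_free (X : finType) :
  frame (fun x : X => basis_elt F x) (fun x (a : {ffun X -> F^o}) => a x : F).
Proof.
split=> [x k a b | a]; first by rewrite !ffunE.
apply/ffunP=> y; rewrite sum_ffunE (bigD1 y) //= !ffunE eqxx [X in X + _](mulr1 (a y : F)).
rewrite big1 ?addr0 // => x /negPf xy; rewrite !ffunE eq_sym xy.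
exact: mulr0.
Qed.

Lemma lftr_pmap_lin (X : finType) (f : X -> option X) :
  lftr (pmap_lin F f) = #|[set x | f x == Some x]|%:R.
Proof.
rewrite (lftrE _ (frame_free X)) -sum1dep_card natr_sum [RHS]big_mkcond /=.
apply: eq_bigr => x _; rewrite pmap_linE; case: (f x) => [y|]; rewrite ffunE //=.
by rewrite eq_sym (inj_eq Some_inj); case: eqP.
Qed.

Section Slices.
Variables (X : finType) (V : vectType F).

Let slice_ex (x : X) : exists f : 'Hom(tensV {ffun X -> F^o} V, V),
  forall a v, f (pure_tens a v) = (a x : F) *: v.
Proof.
apply: tens_univ => [a k v v' | v k a b]; first by rewrite scalerDr !scalerA mulrC.
by rewrite !ffunE scalerDl scalerA.
Qed.

(** The coefficient of the basis element x, in V, of a tensor in F[X] (x) V. *)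
Definition slice (x : X) := sval (boolp.cid (slice_ex x)).

Lemma sliceE x a v : slice x (pure_tens a v) = (a x : F) *: v.
Proof. by rewrite /slice; case: boolp.cid. Qed.

Lemma slice_basis x y v :
  slice x (pure_tens (basis_elt F y) v) = if y == x then v else 0.
Proof. by rewrite sliceE ffunE eq_sym; case: eqP; rewrite ?scale1r ?scale0r. Qed.

Lemma free_tens_ext (W : vectType F) (f g : 'Hom(tensV {ffun X -> F^o} V, W)) :
  (forall x v, f (pure_tens (basis_elt F x) v) = g (pure_tens (basis_elt F x) v)) ->
  f = g.
Proof.
move=> fg; apply: tens_ext => a v; have [_ aE] := frame_free X.
rewrite (aE a) (linear_sumE _ _ (pure_tens_linearl v)) !linear_sum.
by apply: eq_bigr => x _; rewrite !linearZ /= fg.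
Qed.

Lemma sum_slice w : w = \sum_x pure_tens (basis_elt F x) (slice x w).
Proof.
pose gf (w : tensV {ffun X -> F^o} V) :=
  \sum_x pure_tens (basis_elt F x) (slice x w).
have lg : linear gf.
  move=> k w1 w2; rewrite /gf scaler_sumr -big_split; apply: eq_bigr => x _ /=.
  by rewrite linearP pure_tens_linearr.
suff e : \1%VF = linfun gf by rewrite -[LHS]id_lfunE e linfunE.
apply: free_tens_ext => x v; rewrite id_lfunE linfunE // /gf (bigD1 x) //=.
rewrite slice_basis eqxx big1 ?addr0 // => y /negPf xy.
by rewrite slice_basis eq_sym xy pure_tens0r.
Qed.
End Slices.
End TensorSpaces.

Section Balanced.
Variables (F : fieldType) (charF0 : [pchar F] =i pred0).
Variables (A : monoidType) (B : finGroupType).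
Variables (W : bimod F A (opgroup B)) (V : group_rep F B).

(** Up to the factor |B|, the projection of W (x) V onto the invariants of B,
acting by b |-> (w b) (x) (b^-1 v). In characteristic zero its kernel is
[balanced], so that the balanced tensor product behaves like the image of a
projection. *)
Definition balance_avg : 'End(left_tens W V) :=
  \sum_(b : B) tens_lfun (ract W b) (act V b^-1%g).

Let ractM (y z : B) : ract W (y * z)%g = (ract W y \o ract W z)%VF.
Proof. exact: (ract_mul W z y). Qed.

(** The operator of b is the identity up to an element of [balanced]. *)
Lemma tens_lfun_sub_balance (b : B) :
  tens_lfun (ract W b) (act V b^-1%g) =
  (\1 + (balance W V b \o tens_lfun \1 (act V b^-1%g)))%VF.
Proof.
rewrite /balance comp_lfunDl comp_lfunNl -!tens_lfun_comp !comp_lfun1l comp_lfun1r.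
by rewrite -group_actM mulVg group_act1 tens_lfun1 addrC subrK.
Qed.

Lemma balance_avgE w : balance_avg w = #|B|%:R *: w
  + \sum_(b : B) balance W V b (tens_lfun \1%VF (act V b^-1%g) w).
Proof.
rewrite sum_lfunE scaler_nat -sumr_const -big_split /=.
apply: eq_bigr => b _; rewrite tens_lfun_sub_balance add_lfunE id_lfunE.
by rewrite comp_lfunE.
Qed.

Let cB : #|B|%:R != 0 :> F.
Proof.
by rewrite ((pcharf0P F).1 charF0) -lt0n; apply/card_gt0P; exists 1%g.
Qed.

Lemma sum_balance_mem (u : B -> left_tens W V) :
  \sum_(b : B) balance W V b (u b) \in balanced W V.
Proof.
apply: memv_suml => b _.
by apply: (subvP (sumv_sup b _ (subvv _))) => //; rewrite memv_img ?memvf.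
Qed.

(** One inclusion is the invariance of the sum under translation by y. For the
other, the average of w is |B| w up to [balanced], so that |B| w is in
[balanced] if the average vanishes. *)
Lemma mem_balanced w : (w \in balanced W V) = (balance_avg w == 0).
Proof.
apply/idP/eqP=> [/memv_sumP[u uP ->] | avg0].
  rewrite linear_sum big1 // => y _; have /memv_imgP[v _ ->] := uP y isT.
  suff e : (balance_avg \o balance W V y = 0)%VF.
    by have := congr1 (fun f : 'End(left_tens W V) => f v) e; rewrite comp_lfunE zero_lfunE.
  have sumc (I : finType) (f : I -> 'End(left_tens W V)) g :
      ((\sum_i f i) \o g = \sum_i (f i \o g))%VF.
    apply/lfunP=> z; rewrite comp_lfunE !sum_lfunE.
    by apply: eq_bigr => i _; rewrite comp_lfunE.
  rewrite /balance comp_lfunDr comp_lfunNr /balance_avg !sumc; apply/eqP.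
  rewrite subr_eq0; apply/eqP; rewrite [RHS](reindex_inj (mulIg y)) /=.
  apply: eq_bigr => b _; rewrite -!tens_lfun_comp comp_lfun1r -group_actM -ractM.
  by rewrite comp_lfun1r invMg mulgA mulgV mul1g.
have : #|B|%:R *: w \in balanced W V; last by rewrite rpredZeq (negPf cB).
by rewrite -memvN -[- _]addr0 -avg0 balance_avgE addKr sum_balance_mem.
Qed.

(** The trace on the quotient is the trace composed with the averaging
projection ([lftr_quot]), and traces are multiplicative on tensor products. *)
Lemma chr_btens x :
  chr (btens W V) x =
  #|B|%:R^-1 * \sum_(b : B) lftr (act W x \o ract W b)%VF * chr V b^-1%g.
Proof.
rewrite /chr (@lftr_quot _ _ _ (quot_proj (balanced W V)) (linfun vsval)
  (#|B|%:R^-1 *: balance_avg) (left_act W V x)).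
- rewrite -comp_lfunZr linearZ /=; congr (_ * _).
  have -> : (left_act W V x \o balance_avg =
      \sum_(b : B) tens_lfun (act W x \o ract W b) (act V b^-1%g))%VF.
    apply/lfunP=> z; rewrite comp_lfunE !sum_lfunE linear_sum /=.
    by apply: eq_bigr => b _; rewrite -comp_lfunE -tens_lfun_comp comp_lfun1l.
  by rewrite linear_sum; apply: eq_bigr => b _; rewrite /= lftr_tens.
- apply/lfunP=> v; rewrite comp_lfunE id_lfunE -[RHS]quot_proj_id.
  by congr (quot_proj _ _); apply: lfunE.
- apply/lfunP=> v; rewrite comp_lfunE; apply/eqP; rewrite -subr_eq0 -linearB.
  rewrite quot_proj0 scale_lfunE balance_avgE scalerDr scalerA mulVf // scale1r.
  by rewrite addrAC subrr add0r rpredZ // sum_balance_mem.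
- move=> v /eqP; rewrite quot_proj0 mem_balanced => /eqP avg0.
  by rewrite scale_lfunE avg0 scaler0.
- apply/lfunP=> v; rewrite !comp_lfunE; symmetry; exact: (@quot_actE F A (left_tens W V) _ (@balanced_stable F A B W V) x v).
Qed.
End Balanced.

(** * Idempotents of the dual symmetric inverse monoid *)

Section Glue.
Variable n : nat.

(** Two maps p and q with the same image glue the kernel of p to the kernel of
q: the part over a in the domain goes to the part over a in the codomain. All
the elements of I_n^* that are needed are of this form. *)
Lemma glue_ex (K : finType) (p q : 'I_n -> K) :
    (forall i, exists j, p i = q j) -> (forall j, exists i, p i = q j) ->
  exists x : dsim n, forall i j, irel x i j <-> p i = q j.
Proof.
move=> pq qp.
pose G := [set ([set i | p i == p i0], [set j | q j == p i0]) | i0 : 'I_n].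
have GP : is_bij_graph G.
  apply/bij_graphP; split=> [i|j|P Q i|P Q j|P].
  - by exists ([set i' | p i' == p i], [set j | q j == p i]); rewrite ?imset_f ?inE /=.
  - have [i e] := qp j; exists ([set i' | p i' == p i], [set j | q j == p i]).
      exact: imset_f.
    by rewrite inE e.
  - by case/imsetP=> a _ -> /imsetP[b _ ->] /=; rewrite !inE => /eqP<- /eqP<-.
  - by case/imsetP=> a _ -> /imsetP[b _ ->] /=; rewrite !inE => /eqP<- /eqP<-.
  - case/imsetP=> a _ -> /=; split; first by exists a; rewrite inE.
    by have [j e] := pq a; exists j; rewrite inE e.
exists (Dsim GP) => i j; split=> [[_ /imsetP[a _ ->] /=] | pq_ij].
  by rewrite !inE => -[/eqP-> /eqP->].
exists ([set i' | p i' == p i], [set j | q j == p i]); first exact: imset_f.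
by rewrite !inE pq_ij.
Qed.

(** The idempotent of the set partition into the fibres of f. The values are
subsets so that [kerf] gives every set partition; many f give the same
idempotent, which does no harm below. *)
Definition idp (f : {ffun 'I_n -> {set 'I_n}}) : dsim n :=
  sval (boolp.cid (@glue_ex _ f f (fun i => ex_intro _ i erefl) (fun i => ex_intro _ i erefl))).

Lemma idpE f i j : irel (idp f) i j <-> f i = f j.
Proof. by rewrite /idp; case: boolp.cid => x /=. Qed.

Lemma imul_sub_eqv (x y : dsim n) i j :
    (forall i, irel x i i) -> (forall i, irel y i i) ->
  irel (imul x y) i j -> irel (imul y x) i j.
Proof.
move=> xr yr; apply: irel_min => [|{}i c {}j yic xcj]; first exact: irel_difun.
have ic : irel (imul y x) i c by apply: irel_comp (xr _) yic.
have cj : irel (imul y x) c j by apply: irel_comp xcj (yr _).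
have cc : irel (imul y x) c c by apply: irel_comp (xr _) (yr _).
exact: irel_difun ic cc cj.
Qed.

(** The two products are both the idempotent of the join of the two partitions.
*)
Lemma imul_eqvC (x y : dsim n) :
  (forall i, irel x i i) -> (forall i, irel y i i) -> imul x y = imul y x.
Proof. by move=> xr yr; apply: irel_ext => i j; split; apply: imul_sub_eqv. Qed.

Lemma imul_eqv_idem (x : dsim n) : (forall i, irel x i i) -> imul x x = x.
Proof.
move=> xr; apply: irel_ext => i j; split=> [|xij]; last exact: irel_comp xij (xr j).
apply: irel_min => [|{}i c {}j ic cj]; first exact: irel_difun.
exact: irel_difun ic (xr c) cj.
Qed.

(** A map whose fibres are the parts of the domain of x. *)
Definition kerf (x : dsim n) : {ffun 'I_n -> {set 'I_n}} :=
  [ffun i => [set j | boolp.asbool (irel x i j)]].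

Lemma kerfP x i i' : kerf x i = kerf x i' <-> exists j, irel x i j /\ irel x i' j.
Proof.
rewrite !ffunE; split=> [/setP e | [j [ij i'j]]].
  have [j xij] := irel_tot1 x i; exists j; split=> //.
  by have := e j; rewrite !inE (boolp.asboolT xij) => /esym/boolp.asboolW.
apply/setP=> k; rewrite !inE; apply/boolp.asboolP/boolp.asboolP => h.
  exact: irel_difun i'j ij h.
exact: irel_difun ij i'j h.
Qed.

Lemma imul_kerf x : imul x (idp (kerf x)) = x.
Proof.
apply: irel_ext => i j; split=> [|xij].
  apply: irel_min => [|{}i c {}j /idpE/kerfP[k [ik ck]] cj]; first exact: irel_difun.
  exact: irel_difun ik ck cj.
by apply: irel_comp xij; apply/idpE.
Qed.
End Glue.

Section Idempotent.
Variables (n m : nat) (tau : lpart n m).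

(** The number of the part of tau that contains i. *)
Definition lab (i : 'I_n) : 'I_m := sval (boolp.cid (rho_ex tau i)).

Lemma labP i a : (i \in tau a) = (lab i == a).
Proof.
rewrite /lab; case: boolp.cid => b ib /=; apply/idP/eqP=> [ia | <- //].
exact: (rho_uniq ib ia).
Qed.

Lemma lab_surj a : exists i, lab i = a.
Proof. by have [i] := rho_ne tau a; rewrite labP => /eqP; exists i. Qed.

Lemma sdsimE (s : 'S_m) i j : irel (sdsim tau s) i j <-> lab j = s (lab i).
Proof.
rewrite irel_sdsim; split=> [[a] | e]; first by rewrite !labP => /eqP-> /eqP.
by exists (lab i); rewrite labP // e.
Qed.

Local Notation etau := (sdsim tau 1%g).

Lemma etau_refl i : irel etau i i.
Proof. by apply/sdsimE; rewrite perm1. Qed.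

(** The elements x that identify two distinct parts of tau. *)
Definition collapsing (x : dsim n) : Prop :=
  exists i i' j, [/\ irel x i j, irel x i' j & lab i <> lab i'].

(** The kernel of f does not refine tau; equivalently, [idp f] is collapsing. *)
Definition bad (f : {ffun 'I_n -> {set 'I_n}}) : bool :=
  [exists i, exists j, (f i == f j) && (lab i != lab j)].

Lemma badP f : bad f <-> collapsing (idp f).
Proof.
split=> [/existsP[i /existsP[j /andP[/eqP fij /eqP lij]]] | [i [i' [j [/idpE ij /idpE i'j l]]]]].
  by exists i, j, j; split=> //; apply/idpE.
by apply/existsP; exists i; apply/existsP; exists i'; rewrite ij i'j eqxx; apply/eqP.
Qed.

Lemma bad_kerf x : collapsing x -> bad (kerf x).
Proof.
case=> i [i' [j [ij i'j l]]]; apply/existsP; exists i; apply/existsP; exists i'.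
by apply/andP; split; [apply/eqP/kerfP; exists j | apply/eqP].
Qed.

Lemma collapsing_sdsim x (s : 'S_m) : collapsing x -> collapsing (imul x (sdsim tau s)).
Proof.
case=> i [i' [j [ij i'j l]]].
have [a sa] : exists a, irel (sdsim tau s) a i := irel_tot2 _ _.
have [b sb] : exists b, irel (sdsim tau s) b i' := irel_tot2 _ _.
exists a, b, j; split; [exact: irel_comp sa ij | exact: irel_comp sb i'j|].
by move/sdsimE: sa l => ->; move/sdsimE: sb => -> l e; apply: l; rewrite e.
Qed.

(** Suppose that x identifies no two parts of tau. Then x pushes the labelling
lab forward to a labelling q of its codomain. If q is constant on the parts of
tau, it differs from lab by a permutation s, and x e_tau is the inverse of s.
Otherwise x relates two distinct parts of tau to points of one part of tau, and
e_tau x identifies these two parts. *)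
Lemma compress_cases x :
  [\/ exists s, imul x etau = sdsim tau s, collapsing x | collapsing (imul etau x)].
Proof.
have [cx | ncx] := boolp.EM (collapsing x); first by constructor 2.
have lx i i' j : irel x i j -> irel x i' j -> lab i = lab i'.
  by move=> ij i'j; apply: boolp.contrapT => l; apply: ncx; exists i, i', j.
have /boolp.choice[q qP] (j : 'I_n) : exists a, forall i, irel x i j -> lab i = a.
  by have [i ij] := irel_tot2 x j; exists (lab i) => i' i'j; apply: lx i'j ij.
have [[j [j' [l nq]]] | nq] := boolp.EM (exists j j', lab j = lab j' /\ q j <> q j').
  constructor 3; have [i ij] := irel_tot2 x j; have [i' i'j'] := irel_tot2 x j'.
  exists i, i', j; split; [|apply: irel_comp i'j' _|by rewrite (qP _ _ ij) (qP _ _ i'j')].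
    exact: irel_comp ij (etau_refl j).
  by apply/sdsimE; rewrite perm1.
have qlab j j' : lab j = lab j' -> q j = q j'.
  by move=> l; apply: boolp.contrapT => ne; apply: nq; exists j, j'.
constructor 1.
have /boolp.choice[r rP] (a : 'I_m) : exists i, lab i = a := lab_surj a.
pose t a := q (r a).
have tE j : q j = t (lab j) by apply: qlab; rewrite rP.
have tsurj a : exists b, t b = a.
  have [i ia] := lab_surj a; have [j ij] := irel_tot1 x i.
  by exists (lab j); rewrite -tE -(qP _ _ ij).
have tinj : injective t.
  have /boolp.choice[u uP] (a : 'I_m) : exists b, t b = a := tsurj a.
  by apply: (can_inj (g := u)); apply/(bij_can_sym (injF_bij (can_inj uP))).
exists (perm tinj)^-1%g; apply: irel_ext => i j; rewrite sdsimE.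
transitivity (lab i = q j).
  split=> [|lq].
    apply: (@irel_min n x etau (fun i j => lab i = q j)) => [i1 j1 i2 j2 | {}i c {}j].
      by move=> -> <-.
    by move=> /sdsimE; rewrite perm1 => <- /qP.
  have [i' i'j] := irel_tot2 x j; apply: irel_comp (i'j).
  by apply/sdsimE; rewrite perm1 lq; apply: qP.
split=> e; first by rewrite e tE -[t _](permE tinj) permK.
by rewrite tE e -[t _](permE tinj) permKV.
Qed.
End Idempotent.

(** * Compression to a maximal subgroup *)

Section Eop.
Variables (F : fieldType) (n m : nat) (tau : lpart n m).
Implicit Types V : rep F (dsim n).
Local Notation etau := (sdsim tau 1%g).

Lemma dactM V (x y : dsim n) v : act V (imul x y) v = act V x (act V y v).
Proof. by rewrite -comp_lfunE -(act_mul V x y). Qed.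

Definition Eseq V (s : seq {ffun 'I_n -> {set 'I_n}}) : 'End(V) :=
  foldr (fun f g => g - (act V (idp f) \o g))%VF (act V etau) s.

Lemma Eseq_cons V f s v :
  Eseq V (f :: s) v = Eseq V s v - act V (idp f) (Eseq V s v).
Proof. by rewrite /= add_lfunE opp_lfunE comp_lfunE. Qed.

(** The product of the 1 - e_f over the bad f, times e_tau. All the idempotents
commute, so the order is immaterial; e_tau is written last in order that E e_tau
= E be immediate. *)
Definition Eop V := Eseq V (enum (bad tau)).

(** E is the action of one element of the monoid algebra, hence natural in the
module and accessible to traces. *)
Lemma Eop_coef : exists c : dsim n -> F,
  forall V, Eop V = \sum_x c x *: act V x.
Proof.
rewrite /Eop; elim: (enum _) => [|f s [c IHc]].
  exists (fun x => (x == etau)%:R) => V; rewrite (bigD1 etau) //= eqxx scale1r.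
  by rewrite big1 ?addr0 // => x /negPf->; rewrite scale0r.
(* The coefficients of (1 - e_f) times the sum of the c x *: x. *)
exists (fun x => c x - \sum_(y | imul (idp f) y == x) c y) => V.
under eq_bigr do rewrite scalerBl scaler_suml.
rewrite big_split /= -IHc; congr (_ + _); rewrite sumrN; congr (- _).
apply/lfunP=> v; rewrite comp_lfunE IHc !sum_lfunE linear_sum /=.
rewrite (partition_big (fun y => imul (idp f) y) predT) //=.
apply: eq_bigr => x _; rewrite sum_lfunE; apply: eq_bigr => y /eqP <-.
by rewrite !scale_lfunE linearZ /= dactM.
Qed.

Lemma Eop_natural V V' (f : 'Hom(V, V')) :
  (forall x v, f (act V x v) = act V' x (f v)) ->
  forall v, f (Eop V v) = Eop V' (f v).
Proof.
move=> fE v; have [c cE] := Eop_coef; rewrite !cE !sum_lfunE linear_sum.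
by apply: eq_bigr => x _; rewrite !scale_lfunE linearZ /= fE.
Qed.

Lemma idp_refl f i : irel (@idp n f) i i.
Proof. exact/idpE. Qed.

Lemma idp_Eseq V s f v : f \in s -> act V (idp f) (Eseq V s v) = 0.
Proof.
elim: s => // g s IHs; rewrite inE Eseq_cons => /orP[/eqP -> | /IHs fs].
  rewrite linearB /= -dactM (imul_eqv_idem (idp_refl g)).
  exact: subrr.
rewrite linearB /= fs -dactM (imul_eqvC (idp_refl f) (idp_refl g)).
by rewrite dactM fs linear0 subr0.
Qed.

Lemma etau_Eop V v : act V etau (Eop V v) = Eop V v.
Proof.
rewrite /Eop; elim: (enum _) => [|f s IHs].
  by rewrite -dactM sdsimM mulg1.
rewrite Eseq_cons linearB /= IHs -dactM (imul_eqvC (@etau_refl _ _ tau) (idp_refl f)).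
by rewrite dactM IHs.
Qed.

Lemma Eop_etau V v : Eop V (act V etau v) = Eop V v.
Proof.
rewrite /Eop; elim: (enum _) => [|f s IHs]; last by rewrite !Eseq_cons IHs.
by rewrite -dactM sdsimM mulg1.
Qed.

(** x equals x e_f for the map f with the parts of its domain as fibres, and
that f is bad. *)
Lemma collapsing_Eop V x v : collapsing tau x -> act V x (Eop V v) = 0.
Proof.
move=> cx; rewrite -(imul_kerf x) dactM idp_Eseq ?linear0 // mem_enum.
exact: bad_kerf.
Qed.

(** With [etau_Eop] and [collapsing_Eop], this describes the image of E as the
vectors fixed by e_tau and killed by the collapsing elements. *)
Lemma Eop_id V v : act V etau v = v ->
  (forall x, collapsing tau x -> act V x v = 0) -> Eop V v = v.
Proof.
move=> ev cv; rewrite /Eop; have : {subset enum (bad tau) <= bad tau}.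
  by move=> f; rewrite mem_enum.
elim: (enum _) => [//|f s IHs] sub; rewrite Eseq_cons IHs; last first.
  by move=> g gs; rewrite sub // inE gs orbT.
by rewrite cv ?subr0 //; apply/badP/sub; rewrite mem_head.
Qed.

(** The image of E is stable under S_tau: a collapsing element times a
permutation of the parts of tau is again collapsing. *)
Lemma Eop_sdsim V (s : 'S_m) v :
  Eop V (act V (sdsim tau s) (Eop V v)) = act V (sdsim tau s) (Eop V v).
Proof.
apply: Eop_id => [|x cx]; first by rewrite -dactM sdsimM mulg1.
by rewrite -dactM collapsing_Eop //; apply: collapsing_sdsim.
Qed.

Lemma Eop_idem V v : Eop V (Eop V v) = Eop V v.
Proof. by have := @Eop_sdsim V 1%g v; rewrite etau_Eop. Qed.

(** E x E lies in E S_tau or vanishes. In the case of a collapsing e_tau x this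
uses E = E e_tau. *)
Lemma Eop_act_Eop V x v :
  (exists s, Eop V (act V x (Eop V v)) = act V (sdsim tau s) (Eop V v)) \/
  Eop V (act V x (Eop V v)) = 0.
Proof.
case: (compress_cases tau x) => [[s e] | cx | cx].
- by left; exists s; rewrite -[X in act V x X]etau_Eop -dactM e Eop_sdsim.
- by right; rewrite collapsing_Eop ?linear0.
- by right; rewrite -Eop_etau -dactM collapsing_Eop ?linear0.
Qed.

Section ERep.
Variable V : rep F (dsim n).
Local Notation U := (limg (Eop V)).

Lemma mem_limgE v : v \in U -> Eop V v = v.
Proof. by case/memv_imgP=> w _ ->; apply: Eop_idem. Qed.

Lemma EopU v : Eop V v \in U.
Proof. by rewrite memv_img ?memvf. Qed.

Definition E_act (s : 'S_m) : 'End(subvs_of U) :=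
  linfun (vsproj U \o act V (sdsim tau s) \o vsval).

Lemma E_actE s w : vsval (E_act s w) = act V (sdsim tau s) (vsval w).
Proof.
rewrite lfunE /= vsprojK // -(mem_limgE (subvsP w)) -Eop_sdsim; exact: EopU.
Qed.

Fact E_act1 : E_act 1%g = \1%VF.
Proof.
apply/lfunP=> w; apply: subvs_inj; rewrite E_actE id_lfunE.
by rewrite -(mem_limgE (subvsP w)) etau_Eop.
Qed.

Fact E_actM s t : E_act (s * t)%g = (E_act t \o E_act s)%VF.
Proof.
by apply/lfunP=> w; apply: subvs_inj; rewrite comp_lfunE !E_actE -dactM sdsimM.
Qed.

Definition E_rep : group_rep F 'S_m := GroupRep E_act1 E_actM.

Lemma chr_E_rep (s : 'S_m) : chr E_rep s = lftr (act V (sdsim tau s) \o Eop V)%VF.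
Proof.
pose p : 'Hom(V, subvs_of U) := (linfun (vsproj U) \o Eop V)%VF.
pose i : 'Hom(subvs_of U, V) := linfun vsval.
have iE w : i w = vsval w by rewrite lfunE.
have pE v : vsval (p v) = Eop V v.
  by rewrite comp_lfunE lfunE /= vsprojK // EopU.
move: p i iE pE => p i iE pE.
have -> : (act V (sdsim tau s) \o Eop V = (act V (sdsim tau s) \o i) \o p)%VF.
  by apply/lfunP=> v; rewrite !comp_lfunE iE pE.
rewrite lftr_comp; congr lftr; apply/lfunP=> w; apply: subvs_inj.
rewrite E_actE !comp_lfunE pE iE -(mem_limgE (subvsP w)).
by rewrite Eop_sdsim.
Qed.

(** To identify the S_tau-module E V it is enough to embed S equivariantly in V
with image that of E. *)
Lemma isomorphic_E_rep (S : group_rep F 'S_m) (J : 'Hom(S, V)) :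
    injective J -> limg J = U ->
    (forall (s : 'S_m) v, J (act S s v) = act V (sdsim tau s) (J v)) ->
  isomorphic S E_rep.
Proof.
move=> injJ imJ JE; pose f : 'Hom(S, E_rep) := (linfun (vsproj U) \o J)%VF.
have fE v : vsval (f v) = J v.
  by rewrite comp_lfunE lfunE /= vsprojK // -imJ memv_img ?memvf.
exists f; split=> [||s v _].
- apply/eqP; rewrite eqEsubv subvf; apply/subvP=> w _.
  have /memv_imgP[v _ e] : vsval w \in limg J by rewrite imJ subvsP.
  by rewrite (_ : w = f v) ?memv_img ?memvf //; apply: subvs_inj; rewrite fE.
- rewrite capfv; apply/eqP/lker0P=> u v /(congr1 vsval).
  by rewrite !fE => /injJ.
- by apply: subvs_inj; rewrite fE JE [RHS]E_actE fE.
Qed.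

(** A non-zero S_tau-submodule X of E V generates V. Compressing by E, the
module E V is spanned by the E x X, which lie in X by [Eop_act_Eop]. *)
Lemma E_rep_irreducible (w0 : E_rep) : w0 != 0 ->
  irreducible_rep V -> irreducible_rep E_rep.
Proof.
move=> nw0 /irreducible_repP[_ sV]; apply/irreducible_repP; split; first by exists w0.
move=> X sX w wX nw.
(* X as a subspace of V, and the submodule of V that it generates. *)
pose X' : {vspace V} := (linfun vsval @: X)%VS.
pose Y : {vspace V} := (\sum_(x : dsim n) act V x @: X')%VS.
have X'E v : reflect (exists2 w, w \in X & v = vsval w) (v \in X').
  by apply: (iffP memv_imgP) => -[u uX ->]; exists u; rewrite ?lfunE.
have subY x : (act V x @: X' <= Y)%VS by apply: (sumv_sup x).
have Yfull : Y = fullv.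
  apply: (sV Y _ (vsval w)); last by rewrite -(inj_eq subvs_inj) raddf0 in nw.
  - move=> x; rewrite limg_sum; apply/subv_sumP=> y _.
    rewrite -limg_comp -(act_mul V x y).
    exact: subY.
  - by apply: (subvP (subY 1%g)); rewrite act_one lim1g; apply/X'E; exists w.
apply/eqP; rewrite eqEsubv subvf; apply/subvP=> z _.
have : vsval z \in Y by rewrite Yfull memvf.
case/memv_sumP=> y yP zE.
suff : vsval z \in X' by case/X'E=> u uX /subvs_inj->.
rewrite -(mem_limgE (subvsP z)) zE linear_sum /=; apply: memv_suml => x _.
have /memv_imgP[v /X'E[u uX ->] ->] := yP x isT.
have := Eop_act_Eop x (vsval u); rewrite (mem_limgE (subvsP u)) => -[[s ->] | ->].
  apply/X'E; exists (act E_rep s u); first exact: stable_act sX _ _ uX.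
  by rewrite [RHS]E_actE.
exact: mem0v.
Qed.
End ERep.
End Eop.

(** * Elements of a cell as surjections *)

Section Cells.
Variables (n k : nat) (rho : lpart n k).
Local Notation lab := (lab rho).
Implicit Types z : cell rho.

Lemma same_labP i j :
  same_part [set rho a | a : 'I_k] i j <-> lab i = lab j.
Proof.
split=> [/same_rhoP[a] | e].
  by rewrite !labP => /eqP-> /eqP->.
by apply/same_rhoP; exists (lab i); rewrite labP // e.
Qed.

Lemma idom_labP (x : dsim n) : idom x = [set rho a | a : 'I_k] <->
  (forall i i', (exists j, irel x i j /\ irel x i' j) <-> lab i = lab i').
Proof.
split=> [e i i' | h].
  by rewrite -same_labP -e; split=> [/same_idomP // | /same_idomP].
apply: part_ext (idom_partition _) (part_ofP rho) _ => i i'.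
by apply/idP/idP=> [/same_idomP/h/same_labP | /same_labP/h/same_idomP].
Qed.

(** The surjection attached to an element z of the cell: the label of the part
of rho that z maps to the part of j. *)
Definition img z (j : 'I_n) : 'I_k := lab (sval (boolp.cid (irel_tot2 (val z) j))).

Lemma imgP z i j : irel (val z) i j <-> lab i = img z j.
Proof.
have /idom_labP zP : idom (val z) = [set rho a | a : 'I_k] by apply/eqP/(valP z).
rewrite /img; case: boolp.cid => i' /= i'j; split=> [ij | ].
  by apply/zP; exists j.
case/zP=> j' [ij' i'j']; exact: irel_difun ij' i'j' i'j.
Qed.

Lemma img_surj z a : exists j, img z j = a.
Proof.
have [i ia] := lab_surj rho a; have [j ij] := irel_tot1 (val z) i.
by exists j; rewrite -ia; apply/esym/imgP.
Qed.

Lemma img_inj z z' : img z =1 img z' -> z = z'.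
Proof.
move=> e; apply/val_inj/irel_ext => i j.
by split=> [/imgP | /imgP] l; apply/imgP; rewrite l e.
Qed.

Lemma cell_ex (f : 'I_n -> 'I_k) : (forall a, exists j, f j = a) ->
  exists z : cell rho, img z =1 f.
Proof.
move=> fs; have [i|j|x xE] := @glue_ex n _ lab f.
- by have [j <-] := fs (lab i); exists j.
- exact: lab_surj.
have /eqP xc : idom x = [set rho a | a : 'I_k].
  apply/idom_labP=> i i'; split=> [[j [/xE-> /xE->]] // | l].
  by have [j fj] := fs (lab i); exists j; split; apply/xE; rewrite fj.
exists (Sub x xc) => j; have [i ij] := irel_tot2 x j.
by rewrite -(xE i j).1 //; apply/esym/imgP; rewrite SubK.
Qed.

(** The monoid acts on surjections by pushing them forward along its relation,
where this is defined. *)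
Lemma cell_leftP x z z' :
  cell_left x z = Some z' <-> forall i j, irel x i j -> img z i = img z' j.
Proof.
rewrite /cell_left; split=> [|h].
  case: insubP => // y _ yE [<-] i j xij.
  have [a ai] := irel_tot2 (val z) i; rewrite -((imgP z a i).1 ai).
  by apply/imgP; rewrite yE; apply: irel_comp ai xij.
suff -> : imul x (val z) = val z' by rewrite valK.
apply: irel_ext => i j; rewrite imgP; split=> [|l].
  apply: (@irel_min n x (val z) (fun i j => lab i = img z' j)) => [i1 j1 i2 j2|a c b].
    by move=> -> <-.
  by move=> /imgP -> /h.
have [c cj] := irel_tot2 x j; apply: irel_comp (cj).
by apply/imgP; rewrite l (h _ _ cj).
Qed.

(** The right action of S_k on the cell, which on surjections is composition
with the inverse permutation ([img_rmul]). *)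
Definition rmul (s : 'S_k) z : cell rho := odflt z (cell_right s z).

Lemma cell_rmul s z : cell_right s z = Some (rmul s z).
Proof. by rewrite /rmul; have [z' -> _] := cell_rightE s z. Qed.

Lemma val_rmul s z : val (rmul s z) = imul (val z) (sdsim rho s).
Proof. by rewrite /rmul; have [z' -> e] := cell_rightE s z. Qed.

Lemma cell_coarser z : coarser rho (val z).
Proof. exact/coarser_idom/eqP/(valP z). Qed.

Lemma img_rmul (s : 'S_k) z j : img z j = s (img (rmul s z) j).
Proof.
have [i ij] := irel_tot2 (val (rmul s z)) j.
rewrite -((imgP _ _ _).1 ij); move: ij; rewrite val_rmul => /(irel_mul_sdsim _ _ _ (@cell_coarser z)).
case=> a [c [ia ca /imgP <-]].
by move: ia ca; rewrite !labP => /eqP-> /eqP.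
Qed.

Lemma rmulP (s : 'S_k) z z' : (forall j, img z j = s (img z' j)) -> rmul s z = z'.
Proof. by move=> h; apply: img_inj => j; apply: (@perm_inj _ s); rewrite -(img_rmul s) h. Qed.

Lemma rmul1 z : rmul 1%g z = z.
Proof. by apply: rmulP => j; rewrite perm1. Qed.

Lemma rmulK s : cancel (rmul s) (rmul s^-1%g).
Proof. by move=> z; apply: rmulP => j; rewrite (img_rmul s z) permK. Qed.

Lemma rmul_inj z : injective (rmul^~ z).
Proof.
move=> s t /= e; apply/permP=> a; have [j <-] := img_surj (rmul s z) a.
by rewrite -(img_rmul s) e -(img_rmul t).
Qed.

(** The product leaves the cell only if x identifies two parts of the codomain
of z; then x z identifies the corresponding parts of rho. *)
Lemma cell_left_None x z : cell_left x z = None -> collapsing rho (imul x (val z)).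
Proof.
rewrite /cell_left; case: insubP => // /eqP nx _; apply: boolp.contrapT => nc; apply: nx.
apply/idom_labP => i i'; split=> [[j [ij i'j]] | l].
  by apply: boolp.contrapT => ne; apply: nc; exists i, i', j.
apply/same_idomP/same_idom_mul; have /eqP -> := valP z.
exact/same_labP.
Qed.

Fact unit_cell_subproof : idom (sdsim rho 1%g) == [set rho a | a : 'I_k].
Proof. by rewrite sdsim_idom. Qed.
Definition unit_cell : cell rho := Sub (sdsim rho 1%g) unit_cell_subproof.

Lemma cell_left_unit z : cell_left (val z) unit_cell = Some z.
Proof. by rewrite /cell_left sdsim1 ?valK //; apply: cell_coarser. Qed.

Lemma cell_left_sdsim s : cell_left (sdsim rho s) unit_cell = Some (rmul s unit_cell).
Proof.
rewrite /cell_left -[RHS](valK (rmul s unit_cell)) val_rmul /=.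
by rewrite !sdsimM mul1g mulg1.
Qed.

Lemma img_unit j : img unit_cell j = lab j.
Proof. by apply/esym/imgP/sdsimE; rewrite perm1. Qed.

Lemma collapsing_unit x : collapsing rho x -> cell_left x unit_cell = None.
Proof.
case=> i [i' [j [ij i'j l]]]; case e: (cell_left _ _) => [z'|] //.
by case: l; have /cell_leftP h := e; rewrite -!img_unit (h _ _ ij) (h _ _ i'j).
Qed.
End Cells.

(** * Modules induced from a maximal subgroup *)

Section InducedModule.
Variables (F : fieldType) (charF0 : [pchar F] =i pred0).
Variables (n m : nat) (tau : lpart n m) (S : group_rep F 'S_m).
Local Notation W := (cell_bimod tau F).
Local Notation N := (btens W S).
Local Notation T := (left_tens W S).
Local Notation pure h v := (pure_tens (basis_elt F (h : cell tau)) (v : S) : T).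

Lemma ract_basis (s : 'S_m) z : ract W s (basis_elt F z) = basis_elt F (rmul s z).
Proof. by have := pmap_linE F (cell_right s) z; rewrite cell_rmul. Qed.

Lemma act_basis x z : act W x (basis_elt F z) =
  if cell_left x z is Some z' then basis_elt F z' else 0.
Proof. exact: (pmap_linE F (cell_left x) z). Qed.

Lemma act_pure x h v : act T x (pure h v) =
  if cell_left x h is Some h' then pure h' v else 0.
Proof.
rewrite [LHS]tens_lfunE id_lfunE act_basis.
by case: (cell_left x h) => //; apply: pure_tens0l.
Qed.

Lemma balance_pure (s : 'S_m) h v :
  balance W S s (pure h v) = pure (rmul s h) v - pure h (act S s v).
Proof. by rewrite /balance add_lfunE opp_lfunE !tens_lfunE !id_lfunE ract_basis. Qed.

Lemma slice_avg (w : T) (h : cell tau) :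
  slice S h (balance_avg W S w) = \sum_(s : 'S_m) act S s (slice S (rmul s h) w).
Proof.
rewrite sum_lfunE linear_sum /= (reindex_inj invg_inj) /=; apply: eq_bigr => s _.
rewrite invgK; pose f := (slice S h \o tens_lfun (ract W s^-1%g) (act S s))%VF.
suff fE : f = (act S s \o slice S (rmul s h))%VF.
  by have := congr1 (fun f : 'Hom(T, S) => f w) fE; rewrite !comp_lfunE.
apply: free_tens_ext => z v; rewrite !comp_lfunE tens_lfunE.
rewrite ract_basis !slice_basis.
have -> : (rmul s^-1%g z == h) = (z == rmul s h).
  apply/eqP/eqP=> [<- | ->]; last exact: rmulK.
  by rewrite -{1}(invgK s) rmulK.
by case: eqP; rewrite ?linear0.
Qed.

(** The relation of [mem_balanced], coefficient by coefficient. *)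
Lemma mem_balanced_cell (w : T) :
  w \in balanced W S <->
  forall h, \sum_(s : 'S_m) act S s (slice S (rmul s h) w) = 0.
Proof.
rewrite (mem_balanced charF0); split=> [/eqP avg0 h | h].
  by rewrite -slice_avg avg0 linear0.
apply/eqP; rewrite [LHS]sum_slice big1 // => z _; rewrite slice_avg h.
exact: pure_tens0r.
Qed.

(** The class of h (x) v in N = F[L_tau] (x) S, with the tensor product over
S_tau. *)
Definition cls (h : cell tau) (v : S) : N := quot_proj (balanced W S) (pure h v).

Lemma act_cls x h v :
  act N x (cls h v) = if cell_left x h is Some h' then cls h' v else 0.
Proof.
rewrite [LHS](quot_actE (@balanced_stable _ _ _ W S)) act_pure.
by case: (cell_left x h) => //; rewrite linear0.
Qed.

Lemma cls_rmul s h v : cls (rmul s h) v = cls h (act S s v).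
Proof.
apply/eqP; rewrite -subr_eq0 -linearB quot_proj0.
rewrite -balance_pure.
by apply: (subvP (sumv_sup s _ (subvv _))) => //; rewrite memv_img ?memvf.
Qed.

Lemma cls_sum (x : N) : exists v : cell tau -> S, x = \sum_h cls h (v h).
Proof.
exists (fun h => slice S h (vsval x)).
rewrite -[LHS](quot_proj_id x) {1}(sum_slice (vsval x)) linear_sum.
by apply: eq_bigr.
Qed.

(** The embedding of S in N as the classes of e_tau (x) v. These generate N, as
h (x) v is the image of e_tau (x) v under h ([act_unit_cls]). *)
Definition unit_cls : 'Hom(S, N) := linfun (cls (unit_cell tau)).

Lemma unit_clsE v : unit_cls v = cls (unit_cell tau) v.
Proof.
by apply: linfunE => a u1 u2; rewrite /cls (pure_tens_linearr _ a) linearP.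
Qed.

Lemma act_unit_cls h v : act N (val h) (unit_cls v) = cls h v.
Proof. by rewrite unit_clsE act_cls cell_left_unit. Qed.

Lemma unit_cls_equiv (s : 'S_m) v : unit_cls (act S s v) = act N (sdsim tau s) (unit_cls v).
Proof. by rewrite !unit_clsE act_cls cell_left_sdsim cls_rmul. Qed.

Lemma Eop_unit_cls v : Eop tau N (unit_cls v) = unit_cls v.
Proof.
apply: Eop_id => [|x cx]; first by rewrite -unit_cls_equiv group_act1 id_lfunE.
by rewrite unit_clsE act_cls collapsing_unit.
Qed.

Lemma limg_unit_cls : limg unit_cls = limg (Eop tau N).
Proof.
apply/eqP; rewrite eqEsubv; apply/andP; split; apply/subvP=> _ /memv_imgP[x _ ->].
  by rewrite -Eop_unit_cls memv_img ?memvf.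
have [v ->] := cls_sum x; rewrite linear_sum /=; apply: memv_suml => h _.
rewrite -(act_unit_cls h); have := @Eop_act_Eop F n m tau N (val h) (unit_cls (v h)).
rewrite (Eop_unit_cls (v h)) => -[[s ->] | ->]; last exact: mem0v.
by rewrite -unit_cls_equiv memv_img ?memvf.
Qed.

(** The condition of [mem_balanced_cell] for e_tau (x) v, at the element e_tau,
reads v = 0. *)
Lemma unit_cls_inj : injective unit_cls.
Proof.
apply/lker0P; rewrite -subv0; apply/subvP=> v.
rewrite memv_ker unit_clsE quot_proj0 memv0 => /mem_balanced_cell/(_ (unit_cell tau)).
rewrite (bigD1 1%g) //= rmul1 slice_basis eqxx group_act1 id_lfunE big1 => [|s ns].
  by rewrite addr0 => ->.
rewrite slice_basis; case: eqP => [e | _]; last by rewrite linear0.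
case/eqP: ns; apply: (@rmul_inj _ _ _ (unit_cell tau)); by rewrite /= rmul1.
Qed.

(** By the previous lemmas S is isomorphic to E N, which is simple if N is. *)
Lemma irreducible_coefficients : irreducible_rep N -> irreducible_rep S.
Proof.
move=> irrN; have isoSE : isomorphic S (E_rep tau N).
  exact: isomorphic_E_rep unit_cls_inj limg_unit_cls unit_cls_equiv.
apply: (isomorphic_irreducible (isomorphic_sym isoSE)).
have [f [g [gf fg _]]] := (isomorphicP _ _).1 isoSE.
have [v nv] : exists v : S, v != 0.
  have /irreducible_repP[[x nx] _] := irrN.
  have [v xE] := cls_sum x.
  apply: boolp.contrapT => nv; case/eqP: nx; rewrite xE big1 // => h _.
  have -> : v h = 0 by apply/eqP; apply: boolp.contrapT => /negP vh; apply: nv; exists (v h).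
  by rewrite -act_unit_cls !linear0.
apply: (@E_rep_irreducible _ _ _ _ _ (f v)) => //.
apply: contraNneq nv => fv0; rewrite -[v]id_lfunE -gf comp_lfunE fv0 linear0.
exact: eqxx.
Qed.

(** If V is isomorphic to N, then E V is isomorphic to E N, hence to S.
Conversely an isomorphism psi from S to E V extends to Th, which sends h (x) v
to h (psi v), from F[L_tau] (x) S to V. It vanishes on the balanced relations,
and only there: for each h0 of the cell, applying E x0 with x0 an inverse of h0
keeps exactly the terms in the orbit of h0 under S_tau, and psi is injective.
The induced map from N to V is injective and non-zero, and V is simple. *)
Lemma isomorphic_E_repP (V : rep F (dsim n)) :
    irreducible_rep S -> irreducible_rep V ->
  isomorphic V N <-> isomorphic (E_rep tau V) S.
Proof.
move=> /irreducible_repP[[v0 nv0] _] irrV; split=> [/isomorphic_sym isoNV | isoES].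
  have [f [g [gf fg fE]]] := (isomorphicP _ _).1 isoNV.
  apply/isomorphic_sym/(@isomorphic_E_rep _ _ _ tau V S (f \o unit_cls)%VF).
  - move=> u v; rewrite !comp_lfunE => /(congr1 g).
    by rewrite -!(comp_lfunE g f) gf !id_lfunE => /unit_cls_inj.
  - rewrite limg_comp limg_unit_cls; apply/vspaceP=> u; apply/memv_imgP/memv_imgP.
      case=> _ /memv_imgP[w _ ->] ->; exists (f w); rewrite ?memvf //.
      exact: (Eop_natural tau fE).
    case=> w _ ->; exists (Eop tau N (g w)); first by rewrite memv_img ?memvf.
    by rewrite (Eop_natural tau fE) -(comp_lfunE f g) fg id_lfunE.
  - by move=> s v; rewrite !comp_lfunE unit_cls_equiv fE.
have [p [q [qp pq pE]]] := (isomorphicP _ _).1 (isomorphic_sym isoES).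
pose psi : 'Hom(S, V) := (linfun vsval \o p)%VF.
have psiE v : psi v = vsval (p v) by rewrite comp_lfunE lfunE.
have psi_inj : injective psi.
  move=> u v; rewrite !psiE => /subvs_inj/(congr1 q).
  by rewrite -!(comp_lfunE q p) qp !id_lfunE.
have psi_equiv s v : psi (act S s v) = act V (sdsim tau s) (psi v).
  by rewrite !psiE pE [LHS]E_actE.
have Epsi v : Eop tau V (psi v) = psi v.
  by rewrite psiE; apply/mem_limgE/subvsP.
move: psi psi_inj psi_equiv Epsi {psiE} => psi psi_inj psi_equiv Epsi.
pose Th : 'Hom(T, V) := \sum_(h : cell tau) (act V (val h) \o psi \o slice S h)%VF.
have ThE w : Th w = \sum_h act V (val h) (psi (slice S h w)).
  by rewrite sum_lfunE; apply: eq_bigr => h _; rewrite !comp_lfunE.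
have Thpure h v : Th (pure h v) = act V (val h) (psi v).
  rewrite ThE (bigD1 h) //= slice_basis eqxx big1 ?addr0 // => h' nh.
  by rewrite slice_basis eq_sym (negPf nh) !linear0.
clearbody Th.
have Th_act x w : Th (act T x w) = act V x (Th w).
  suff e : (Th \o act T x = act V x \o Th)%VF.
    by have := congr1 (fun f : 'Hom(T, V) => f w) e; rewrite !comp_lfunE.
  apply: free_tens_ext => h v; rewrite !comp_lfunE Thpure.
  rewrite act_pure.
  case e: (cell_left x h) => [h'|].
    rewrite Thpure -dactM; congr (act V _ _).
    by move: e; rewrite /cell_left; case: insubP => // y _ <- [->].
  rewrite -dactM -Epsi collapsing_Eop; last exact: cell_left_None e.
  exact: linear0.
have Th_bal w : w \in balanced W S -> Th w = 0.
  case/memv_sumP=> u uP ->; rewrite linear_sum big1 //= => s _.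
  have /memv_imgP[{}w _ ->] := uP s isT.
  suff e : (Th \o balance W S s = 0)%VF.
    by have := congr1 (fun f : 'Hom(T, V) => f w) e; rewrite comp_lfunE zero_lfunE.
  apply: free_tens_ext => h v; rewrite comp_lfunE zero_lfunE.
  rewrite balance_pure linearB /= !Thpure.
  by rewrite val_rmul dactM psi_equiv subrr.
have Th_ker w : Th w = 0 -> w \in balanced W S.
  move=> Thw; apply/mem_balanced_cell => h0; apply: psi_inj; rewrite linear0 linear_sum.
  (* An inverse of h0: it carries the surjection of h0 to that of e_tau. *)
  have [|a|x0 x0E] := @glue_ex n _ (img h0) (lab tau).
  - by move=> i; have [j e] := lab_surj tau (img h0 i); exists j.
  - exact: img_surj.
  pose G h := Eop tau V (act V x0 (act V (val h) (psi (slice S h w)))).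
  have : \sum_h G h = 0.
    have e : Eop tau V (act V x0 (Th w)) = 0 by rewrite Thw !linear0.
    by rewrite -[RHS]e ThE !linear_sum.
  have x0s s : imul x0 (val (rmul s h0)) = sdsim tau s.
    rewrite val_rmul imulA; suff -> : imul x0 (val h0) = sdsim tau 1%g.
      by rewrite sdsimM mulg1.
    have : cell_left x0 h0 = Some (unit_cell tau).
      by apply/cell_leftP=> i j /x0E ->; rewrite img_unit.
    by rewrite /cell_left; case: insubP => // y _ <- [->].
  have Gs s : G (rmul s h0) = psi (act S s (slice S (rmul s h0) w)).
    by rewrite /G -dactM x0s psi_equiv -Epsi Eop_sdsim Epsi.
  rewrite (bigID (mem [set rmul s h0 | s : 'S_m])) /= [X in _ + X]big1 ?addr0.
    rewrite big_imset /=; last by move=> s t _ _; apply: rmul_inj.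
    by move=> e; rewrite -[RHS]e; apply: eq_big => [s|s _]; rewrite ?inE // Gs.
  move=> h nh; rewrite /G -dactM.
  case: (@Eop_act_Eop _ _ _ tau V (imul x0 (val h)) (psi (slice S h w))); rewrite Epsi //.
  case: (compress_cases tau (imul x0 (val h))) => [[s e] _ | cx _ | cx _].
  - case/imsetP: nh; exists s => //; symmetry; apply: rmulP => i.
    rewrite -imulA sdsim1 in e; last exact: cell_coarser.
    have [j ij] := irel_tot1 x0 i.
    have : cell_left x0 h = Some (rmul s (unit_cell tau)).
      have val_s : val (rmul s (unit_cell tau)) = sdsim tau s.
        by rewrite val_rmul /= sdsimM mulg1.
      by rewrite /cell_left e -val_s valK.
    move/cell_leftP=> hx; rewrite (hx _ _ ij) (x0E i j).1 //.
    by rewrite -(img_rmul s) img_unit.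
  - by rewrite -Epsi collapsing_Eop ?linear0.
  - by rewrite -Eop_etau -dactM -Epsi collapsing_Eop ?linear0.
apply/isomorphic_sym.
pose f : 'Hom(N, V) := (Th \o linfun vsval)%VF.
have fE w : f (quot_proj (balanced W S) w) = Th w.
  rewrite comp_lfunE lfunE /=; apply/eqP; rewrite eq_sym -subr_eq0 -linearB /=.
  by rewrite Th_bal // quot_projK.
have f_act x u : f (act N x u) = act V x (f u).
  by rewrite -(quot_proj_id u) [act N x _](quot_actE (@balanced_stable _ _ _ W S)) !fE Th_act.
exists f; split=> [||x u _]; last exact: f_act.
  have /irreducible_repP[_ sV] := irrV.
  apply: (sV _ _ (psi v0)).
  - move=> x; apply/subvP=> _ /memv_imgP[_ /memv_imgP[u _ ->] ->].
    by rewrite -f_act memv_img ?memvf.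
  - have -> : psi v0 = f (cls (unit_cell tau) v0); last by rewrite memv_img ?memvf.
    by rewrite fE Thpure -psi_equiv group_act1 id_lfunE.
  - by apply: contraNneq nv0 => e; apply/eqP/psi_inj; rewrite e linear0.
apply/eqP; rewrite capfv -subv0; apply/subvP=> u; rewrite memv_ker memv0.
by rewrite -(quot_proj_id u) fE quot_proj0 => /eqP/Th_ker.
Qed.

End InducedModule.

(** * Character formulas for multiplicities *)

Section MultFormulas.
Variables (F : closedFieldType) (charF0 : [pchar F] =i pred0).

Lemma natf_neq0 (gT : finGroupType) : #|gT|%:R != 0 :> F.
Proof.
by rewrite ((pcharf0P F).1 charF0) -lt0n; apply/card_gt0P; exists 1%g.
Qed.

Lemma mult_group (gT : finGroupType) (S V : group_rep F gT) : irreducible_rep S ->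
  (mult V S)%:R = #|gT|%:R^-1 * \sum_(g : gT) chr S g^-1%g * chr V g.
Proof.
move=> irrS; rewrite mulr_sumr.
rewrite (@mult_trace F (opgroup gT) gT (fun g => #|gT|%:R^-1 * chr S g^-1%g) (fun g => g) S).
  by apply: eq_bigr => g _; rewrite mulrA.
move=> Q irrQ; under eq_bigr do rewrite -mulrA.
by rewrite -mulr_sumr chr_orthogonality // mulKf // natf_neq0.
Qed.

Lemma lftr_Eop (n m : nat) (tau : lpart n m) : exists c : dsim n -> F,
  forall (V : rep F (dsim n)) y (R : 'End(V)),
    lftr (act V y \o Eop tau V \o R)%VF = \sum_x c x * lftr (act V (imul y x) \o R)%VF.
Proof.
have [c cE] := Eop_coef F tau; exists c => V y R.
have -> : (act V y \o Eop tau V \o R = \sum_x c x *: (act V (imul y x) \o R))%VF.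
  apply/lfunP=> v; rewrite !comp_lfunE cE !sum_lfunE linear_sum /=.
  by apply: eq_bigr => x _; rewrite !scale_lfunE linearZ /= comp_lfunE dactM.
by rewrite linear_sum; apply: eq_bigr => x _; rewrite linearZ.
Qed.

Lemma mult_cell_simple (n m : nat) (tau : lpart n m) (S : group_rep F 'S_m)
    (V : rep F (dsim n)) : irreducible_rep S ->
  (mult V (btens (cell_bimod tau F) S))%:R =
  #|'S_m|%:R^-1 * \sum_(s : 'S_m) chr S s^-1%g * lftr (act V (sdsim tau s) \o Eop tau V)%VF.
Proof.
move=> irrS; have [c cE] := lftr_Eop tau.
have trE (Q : rep F (dsim n)) s : lftr (act Q (sdsim tau s) \o Eop tau Q)%VF =
    \sum_x c x * chr Q (imul (sdsim tau s) x).
  rewrite -[X in lftr X]comp_lfun1r cE.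
  by apply: eq_bigr => x _; rewrite comp_lfun1r.
have sumE (Q : rep F (dsim n)) :
    #|'S_m|%:R^-1 * \sum_(s : 'S_m) chr S s^-1%g * lftr (act Q (sdsim tau s) \o Eop tau Q)%VF =
    \sum_(p : 'S_m * dsim n) #|'S_m|%:R^-1 * chr S p.1^-1%g * c p.2 * chr Q (imul (sdsim tau p.1) p.2).
  transitivity (\sum_s \sum_x #|'S_m|%:R^-1 * chr S s^-1%g * c x * chr Q (imul (sdsim tau s) x)).
    rewrite mulr_sumr; apply: eq_bigr => s _; rewrite trE mulrA mulr_sumr.
    by apply: eq_bigr => x _; rewrite !mulrA.
  by rewrite pair_bigA.
rewrite sumE; apply: mult_trace => Q irrQ; rewrite -sumE.
have [[w nw] | E0] := boolp.EM (exists w : E_rep tau Q, w != 0).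
  have irrE := E_rep_irreducible nw irrQ.
  rewrite (boolp.asbool_equiv_eq (isomorphic_E_repP charF0 tau irrS irrQ)).
  under eq_bigr do rewrite -chr_E_rep.
  by rewrite chr_orthogonality // mulKf // natf_neq0.
have Eop0 v : Eop tau Q v = 0.
  have := boolp.contrapT; move=> ct; apply: ct => nE; apply: E0.
  exists (vsproj _ (Eop tau Q v)); apply/eqP => /(congr1 vsval).
  by rewrite vsprojK ?EopU //.
rewrite big1 ?mulr0; last first.
  move=> s _; have -> : (act Q (sdsim tau s) \o Eop tau Q = 0)%VF.
    by apply/lfunP=> v; rewrite comp_lfunE Eop0 linear0 zero_lfunE.
  by rewrite linear0 mulr0.
case: boolp.asboolP => // iso; case: E0.
have [f [g [gf fg _]]] := (isomorphicP _ _).1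
  ((isomorphic_E_repP charF0 tau irrS irrQ).1 iso).
have /irreducible_repP[[v nv] _] := irrS; exists (g v).
by apply: contraNneq nv => gv; rewrite -[v]id_lfunE -fg comp_lfunE gv linear0.
Qed.

Lemma mult_cell_simple0 (n m : nat) (tau : lpart n m) (S : group_rep F 'S_m)
    (V : rep F (dsim n)) : ~ irreducible_rep S ->
  mult V (btens (cell_bimod tau F) S) = 0%N.
Proof. by move=> nS; apply: mult_not_irreducible => /(irreducible_coefficients charF0). Qed.

Section TensorTrace.
Variables (n k l : nat) (rho : lpart n k) (sigma : lpart n l).
Variables (S1 : group_rep F 'S_k) (S2 : group_rep F 'S_l).
Local Notation C1 := (cell_bimod rho F).
Local Notation C2 := (cell_bimod sigma F).
Local Notation V := (tens_rep (btens C1 S1) (btens C2 S2)).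
Local Notation C := (tens_rep C1 C2).

(** The characters of the two factors are averages over S_k and S_l of traces on
cell modules tensored with the coefficients; as E is a combination of elements
of the monoid, the product of the two can be reassembled into one trace on the
tensor product of the cell modules. *)
Lemma lftr_tens_cells (m : nat) (tau : lpart n m) y :
  lftr (act V y \o Eop tau V)%VF =
  (#|'S_k|%:R * #|'S_l|%:R)^-1 *
  \sum_(h : 'S_k * 'S_l) chr S1 h.1^-1%g * chr S2 h.2^-1%g *
     lftr (act C y \o Eop tau C \o tens_lfun (ract C1 h.1) (ract C2 h.2))%VF.
Proof.
have [c cE] := lftr_Eop tau.
rewrite -[X in lftr X]comp_lfun1r cE.
under [in RHS]eq_bigr => h _ do
  rewrite (cE C y (tens_lfun (ract C1 h.1) (ract C2 h.2))) mulr_sumr.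
rewrite exchange_big mulr_sumr; apply: eq_bigr => x _ /=.
rewrite comp_lfun1r.
have -> : lftr (act V (imul y x)) =
    chr (btens C1 S1) (imul y x) * chr (btens C2 S2) (imul y x) by apply: lftr_tens.
rewrite !(chr_btens charF0).
pose f (s : 'S_k) := lftr (act C1 (imul y x) \o ract C1 s)%VF * chr S1 s^-1%g.
pose g (t : 'S_l) := lftr (act C2 (imul y x) \o ract C2 t)%VF * chr S2 t^-1%g.
rewrite -[\sum_b lftr (act C1 _ \o _)%VF * _]/(\sum_s f s).
rewrite -[\sum_b lftr (act C2 _ \o _)%VF * _]/(\sum_t g t).
rewrite (eq_bigr (fun h => c x * (f h.1 * g h.2))); last first.
  move=> h _; rewrite -tens_lfun_comp lftr_tens mulrCA; congr (_ * _).
  by rewrite mulrACA; congr (_ * _); apply: mulrC.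
rewrite -mulr_sumr -(pair_bigA _ (fun s t => f s * g t)) /= -big_distrlr /=.
by rewrite invfM [in LHS]mulrACA; apply: mulrCA.
Qed.
End TensorTrace.
End MultFormulas.

(** * The compression operator on pairs of cells *)

Section EopBasis.
Variables (F : fieldType) (n k l m : nat).
Variables (rho : lpart n k) (sigma : lpart n l) (tau : lpart n m).
Local Notation C1 := (cell_bimod rho F).
Local Notation C2 := (cell_bimod sigma F).
Local Notation C := (tens_rep C1 C2).
Local Notation lab := (lab tau).
Local Notation bas z w := (pure_tens (basis_elt F (z : cell rho)) (basis_elt F (w : cell sigma)) : C).

Lemma Eop_idp (V : rep F (dsim n)) f v : bad tau f -> Eop tau V (act V (idp f) v) = 0.
Proof.
move=> bf; suff -> : Eop tau V (act V (idp f) v) = act V (idp f) (Eop tau V v).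
  by rewrite collapsing_Eop //; apply/badP.
rewrite /Eop; elim: (enum _) => [|g s IHs].
  by rewrite -!dactM (imul_eqvC (@etau_refl _ _ tau) (@idp_refl _ f)).
rewrite !Eseq_cons IHs linearB /= -!dactM.
by rewrite (imul_eqvC (@idp_refl _ f) (@idp_refl _ g)).
Qed.

(** The joint kernel of the surjections of z and w is tau. *)
Definition sep (z : cell rho) (w : cell sigma) : bool :=
  [forall i, forall j, ((img z i == img z j) && (img w i == img w j)) == (lab i == lab j)].

Lemma sepP z w :
  reflect (forall i j, img z i = img z j /\ img w i = img w j <-> lab i = lab j) (sep z w).
Proof.
apply: (iffP forallP) => h i; [move=> j | apply/forallP=> j].
  have /forallP/(_ j)/eqP e := h i.
  split=> [[/eqP e1 /eqP e2] | /eqP]; first by apply/eqP; rewrite -e e1 e2.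
  by rewrite -e => /andP[/eqP-> /eqP->].
apply/eqP; apply/andP/eqP => [[/eqP e1 /eqP e2] | /h[-> ->] //]; exact/h.
Qed.

Lemma act_bas x z w : act C x (bas z w) =
  match cell_left x z, cell_left x w with
  | Some z', Some w' => bas z' w'
  | _, _ => 0
  end.
Proof.
rewrite [LHS]tens_lfunE !act_basis.
by case: (cell_left x z) => [z'|]; case: (cell_left x w) => [w'|];
  rewrite ?pure_tens0l ?pure_tens0r.
Qed.

(** Idempotents fix or kill the pair (z, w). If the pair is not constant on the
parts of tau, then e_tau kills it. If it is constant but identifies two parts of
tau, then it is fixed by a bad idempotent, which E annihilates. Otherwise it is
fixed by e_tau and killed by the collapsing elements. *)
Lemma Eop_bas z w : Eop tau C (bas z w) = if sep z w then bas z w else 0.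
Proof.
have [cz | ncz] := boolp.EM (forall i j, lab i = lab j -> img z i = img z j /\ img w i = img w j); last first.
  case: ifP => [/sepP sp | _]; first by case: ncz => i j /sp.
  rewrite -Eop_etau act_bas.
  case ez: (cell_left _ z) => [z'|]; last by rewrite linear0.
  case ew: (cell_left _ w) => [w'|]; last by rewrite linear0.
  case: ncz => i j lij; move/cell_leftP: ez => ez; move/cell_leftP: ew => ew.
  have e1 : irel (sdsim tau 1%g) i j by apply/sdsimE; rewrite perm1.
  have e2 : irel (sdsim tau 1%g) j j by apply/sdsimE; rewrite perm1.
  by rewrite (ez _ _ e1) (ew _ _ e1) (ez _ _ e2) (ew _ _ e2).
have fixed x : (forall i j, irel x i j -> img z i = img z j /\ img w i = img w j) ->
    act C x (bas z w) = bas z w.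
  move=> h; rewrite act_bas.
  have -> : cell_left x z = Some z by apply/cell_leftP => i j /h[].
  by have -> : cell_left x w = Some w by apply/cell_leftP => i j /h[].
case: ifP => [/sepP sp | /negP nsp].
  apply: Eop_id => [|x [i [i' [j [ij i'j ne]]]]].
    by apply: fixed => i j /sdsimE; rewrite perm1 => /esym/cz.
  rewrite act_bas; case ez: (cell_left _ z) => [z'|] //.
  case ew: (cell_left _ w) => [w'|] //.
  move/cell_leftP: ez => ez; move/cell_leftP: ew => ew.
  by case: ne; apply/sp; rewrite (ez _ _ ij) (ez _ _ i'j) (ew _ _ ij) (ew _ _ i'j).
pose f : {ffun 'I_n -> {set 'I_n}} :=
  [ffun i => [set j | (img z i == img z j) && (img w i == img w j)]].
have fP i j : f i = f j <-> img z i = img z j /\ img w i = img w j.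
  rewrite !ffunE; split=> [/setP/(_ j) | [ez ew]]; last by rewrite ez ew.
  by rewrite !inE !eqxx => /andP[/eqP-> /eqP->].
rewrite -(fixed (idp f)) => [|i j /idpE/fP //]; apply: Eop_idp.
apply: boolp.contrapT => nbf; apply: nsp; apply/sepP => i j; split=> [/fP e | /cz //].
apply/eqP; apply: boolp.contrapT => nl; apply: nbf.
by apply/existsP; exists i; apply/existsP; exists j; rewrite e eqxx; apply/negP.
Qed.

Lemma lftr_cells_count (g : 'S_m) (h : 'S_k * 'S_l) :
  lftr (act C (sdsim tau g) \o Eop tau C \o tens_lfun (ract C1 h.1) (ract C2 h.2))%VF =
  #|[set p : cell rho * cell sigma |
     [&& sep (rmul h.1 p.1) (rmul h.2 p.2),
       cell_left (sdsim tau g) (rmul h.1 p.1) == Some p.1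
     & cell_left (sdsim tau g) (rmul h.2 p.2) == Some p.2]]|%:R.
Proof.
have [th thE fr] := frame_tens (frame_free F (cell rho)) (frame_free F (cell sigma)).
rewrite (lftrE _ fr) -sum1dep_card natr_sum [RHS]big_mkcond /=.
apply: eq_bigr => p _.
rewrite 2!comp_lfunE.
have e : tens_lfun (ract C1 h.1) (ract C2 h.2) (bas p.1 p.2) =
    bas (rmul h.1 p.1) (rmul h.2 p.2) by rewrite tens_lfunE !ract_basis.
rewrite [X in Eop tau C X]e.
have th0 : th p 0 = 0 by apply: scalar_at0 (fr.1 p).
rewrite Eop_bas.
case: (sep _ _); last by rewrite linear0 th0.
rewrite act_bas; case: (cell_left _ (rmul h.1 p.1)) => [z'|] //.
case: (cell_left _ (rmul h.2 p.2)) => [w'|]; last by rewrite andbF.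
rewrite thE /= !ffunE !(inj_eq Some_inj) [z' == _]eq_sym [w' == _]eq_sym.
by case: eqP => _; case: eqP => _; rewrite ?mul1r ?mul0r.
Qed.
End EopBasis.

(** * Labellings of 0/1-matrices *)

Section Labellings.
Variables (k l m : nat).
Local Notation labelling := {ffun 'I_m -> 'I_k * 'I_l}.

Definition commutes (g : 'S_m) (h : 'S_k * 'S_l) (be : labelling) : bool :=
  [forall a, perm_cell h (be (g a)) == be a].

Definition surj_labellings (g : 'S_m) (h : 'S_k * 'S_l) : {set labelling} :=
  [set be : labelling | [&& injectiveb be, [forall i, exists a, (be a).1 == i],
     [forall j, exists a, (be a).2 == j] & commutes g h be]].

(** Bijections from the labels to the entries of M equal to 1, for which the
relabelling by g is undone by h. *)
Definition labellings_of (M : Qmat k l m) (g : 'S_m) (h : 'S_k * 'S_l) : {set labelling} :=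
  [set be : labelling | [&& injectiveb be, [set be a | a : 'I_m] == ones (val M)
     & commutes g h be]].

(** The image of an injective labelling that meets all rows and columns is the
support of exactly one matrix. *)
Lemma card_surj_labellings g h :
  #|surj_labellings g h| = (\sum_(M : Qmat k l m) #|labellings_of M g h|)%N.
Proof.
rewrite -sum1dep_card big_mkcond /=.
rewrite [RHS](eq_bigr (fun M : Qmat k l m => \sum_(be : labelling) (be \in labellings_of M g h : nat))%N); last first.
  by move=> M _; rewrite -sum1_card big_mkcond; apply: eq_bigr => be _; case: (_ \in _).
rewrite exchange_big; apply: eq_bigr => be _ /=.
case: ifP => [/and4P[injb rb cb cmb] | nb]; last first.
  rewrite big1 // => M _; apply/eqP; rewrite eqb0; apply: contraFN nb.
  rewrite inE => /and3P[-> /eqP im ->]; rewrite andbT /=.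
  have /and3P[_ rM cM] := valP M.
  have imE i j : val M i j -> exists a, be a = (i, j).
    move=> Mij; have : (i, j) \in ones (val M) by rewrite inE.
    by rewrite -im => /imsetP[a _ ->]; exists a.
  apply/andP; split; apply/forallP=> i.
    have /existsP[j /imE[a e]] := forallP rM i.
    by apply/existsP; exists a; rewrite e.
  have /existsP[j /imE[a e]] := forallP cM i.
  by apply/existsP; exists a; rewrite e.
pose M0 : 'M[bool]_(k, l) := \matrix_(i, j) ((i, j) \in [set be a | a : 'I_m]).
have onesM0 : ones M0 = [set be a | a : 'I_m].
  by apply/setP=> -[i j]; rewrite inE mxE.
have QM0 : is_Qmat m M0.
  apply/and3P; split.
  - by rewrite onesM0 card_imset ?card_ord //; apply/injectiveP.
  - apply/forallP=> i; have /existsP[a /eqP <-] := forallP rb i.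
    by apply/existsP; exists (be a).2; rewrite mxE -surjective_pairing imset_f.
  - apply/forallP=> j; have /existsP[a /eqP <-] := forallP cb j.
    by apply/existsP; exists (be a).1; rewrite mxE -surjective_pairing imset_f.
pose M : Qmat k l m := Sub M0 QM0; have valM : val M = M0 by apply: SubK.
rewrite (bigD1 M) //= big1 => [|M' nM].
  by rewrite addn0 inE injb cmb valM onesM0 eqxx.
apply/eqP; rewrite eqb0 inE; apply: contra nM => /and3P[_ /eqP im _].
apply/eqP/val_inj/matrixP=> i j; rewrite valM mxE im.
by rewrite inE.
Qed.

Section Cells.
Variables (n : nat) (rho : lpart n k) (sigma : lpart n l) (tau : lpart n m).
Local Notation lab := (lab tau).

(** A pair of surjections with joint kernel tau factors through the labels of
the parts of tau, as an injective labelling. *)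
Lemma card_fixed_cells (g : 'S_m) (h : 'S_k * 'S_l) :
  #|[set p : cell rho * cell sigma |
     [&& sep tau (rmul h.1 p.1) (rmul h.2 p.2),
       cell_left (sdsim tau g) (rmul h.1 p.1) == Some p.1
     & cell_left (sdsim tau g) (rmul h.2 p.2) == Some p.2]]| =
  #|surj_labellings g h|.
Proof.
have /boolp.choice[r rP] (a : 'I_m) : exists i, lab i = a := lab_surj tau a.
have leftP q (pi : lpart n q) (s : 'S_q) (z : cell pi) :
    cell_left (sdsim tau g) (rmul s z) = Some z <->
    (forall i j, lab j = g (lab i) -> img z i = s (img z j)).
  rewrite cell_leftP; split=> e i j.
    by move=> /sdsimE/e eij; rewrite (img_rmul s) eij.
  by move=> /sdsimE/e; rewrite (img_rmul s z i) => /perm_inj.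
pose P := [pred p : cell rho * cell sigma |
     [&& sep tau (rmul h.1 p.1) (rmul h.2 p.2),
       cell_left (sdsim tau g) (rmul h.1 p.1) == Some p.1
     & cell_left (sdsim tau g) (rmul h.2 p.2) == Some p.2]].
have PP p : reflect [/\ forall i j, (img p.1 i = img p.1 j /\ img p.2 i = img p.2 j <-> lab i = lab j),
      forall i j, lab j = g (lab i) -> img p.1 i = h.1 (img p.1 j)
    & forall i j, lab j = g (lab i) -> img p.2 i = h.2 (img p.2 j)] (P p).
  apply: (iffP and3P) => [[/sepP sp /eqP/leftP e1 /eqP/leftP e2] | [sp e1 e2]].
    split=> // i j; rewrite -sp !(img_rmul h.1 p.1) !(img_rmul h.2 p.2).
    by split=> [[/perm_inj -> /perm_inj ->] | [-> ->]].
  split; try exact/eqP/leftP.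
  apply/sepP=> i j; rewrite -sp !(img_rmul h.1 p.1) !(img_rmul h.2 p.2).
  by split=> [[-> ->] | [/perm_inj -> /perm_inj ->]].
pose phi (p : cell rho * cell sigma) : labelling :=
  [ffun a => (img p.1 (r a), img p.2 (r a))].
have phiE p i : P p -> phi p (lab i) = (img p.1 i, img p.2 i).
  by case/PP=> sp _ _; rewrite ffunE; have [|-> ->] := (sp (r (lab i)) i).2.
rewrite -(card_in_imset (f := phi)); last first.
  move=> [z w] [z' w']; rewrite !inE => Pp Pq e.
  congr (_, _); apply: img_inj => i.
    by have := phiE _ i Pp; rewrite e phiE // => -[].
  by have := phiE _ i Pp; rewrite e phiE // => -[].
apply: eq_card => be; rewrite inE; apply/imsetP/and4P => [[p + ->] | [/injectiveP injb rb cb cm]].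
  rewrite inE => Pp; have [sp e1 e2] := PP _ Pp; split.
  - apply/injectiveP=> a b; rewrite !ffunE => -[e3 e4].
    by rewrite -(rP a) -(rP b); apply/sp.
  - apply/forallP=> i; have [j e] := img_surj p.1 i.
    by apply/existsP; exists (lab j); rewrite phiE //= e.
  - apply/forallP=> i; have [j e] := img_surj p.2 i.
    by apply/existsP; exists (lab j); rewrite phiE //= e.
  - apply/forallP=> a; rewrite !ffunE /perm_cell /=.
    by rewrite -(e1 (r a)) -?(e2 (r a)) ?rP.
have [i|z zE] := @cell_ex n k rho (fun i => (be (lab i)).1).
  have /existsP[a /eqP <-] := forallP rb i; exists (r a); by rewrite rP.
have [i|w wE] := @cell_ex n l sigma (fun i => (be (lab i)).2).
  have /existsP[a /eqP <-] := forallP cb i; exists (r a); by rewrite rP.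
exists (z, w); last by apply/ffunP=> a; rewrite ffunE /= zE wE rP -surjective_pairing.
have cmE i j : lab j = g (lab i) -> be (lab i) = perm_cell h (be (lab j)).
  by move=> ->; have /eqP := forallP cm (lab i).
rewrite inE; apply/PP; split=> i j /=; rewrite !(zE, wE).
- split=> [[e1 e2] | -> //]; apply: injb.
  by rewrite [LHS]surjective_pairing e1 e2 -surjective_pairing.
- by move/cmE->.
- by move/cmE->.
Qed.
End Cells.
End Labellings.

(** * Orbits of 0/1-matrices *)

Lemma big_subg (R : Type) (idx : R) (op : Monoid.com_law idx) (gT : finGroupType)
    (H : {group gT}) (E : gT -> R) :
  \big[op/idx]_(u : subg_of H) E (sgval u) = \big[op/idx]_(h in H) E h.
Proof.
rewrite (reindex_onto sgval (subg H)) => [|h Hh]; last exact: subgK.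
by apply: eq_bigl => u; rewrite subgP sgvalK eqxx.
Qed.

Lemma card_subg_of (gT : finGroupType) (H : {group gT}) : #|subg_of H| = #|H|.
Proof. by rewrite -[RHS]sum1_card -(big_subg _ _ (fun=> 1%N)) sum1_card. Qed.

Section MatrixOrbits.
Variables (F : closedFieldType) (charF0 : [pchar F] =i pred0).
Variables (k l m : nat) (U : group_rep F ('S_k * 'S_l)%type).
Implicit Types (M : Qmat k l m) (g : 'S_m) (h : 'S_k * 'S_l).

(** A labelling of the entries of M that commutes with h forces h to preserve
these entries. *)
Lemma labellings_Qstab M g h be : be \in labellings_of M g h -> h \in Qstab M.
Proof.
rewrite inE => /and3P[_ /eqP im /forallP cm]; apply/astab1P/val_inj.
apply/matrixP=> i j; have imh : ones (perm_mat h (val M)) = ones (val M).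
  rewrite ones_perm_mat -im; apply/setP=> p; apply/imsetP/imsetP.
    case=> _ /imsetP[a _ ->] ->; exists (g^-1%g a) => //.
    by have /eqP := cm (g^-1%g a); rewrite permKV.
  by case=> a _ ->; exists (be (g a)); [apply: imset_f | have /eqP := cm a].
by have /setP/(_ (i, j)) := imh; rewrite !inE.
Qed.

(** Up to the order of the stabilizer of M, the character of the module induced
from it. The sum runs over the whole group because only elements of the
stabilizer contribute ([labellings_Qstab]); in this form it can be compared
along an orbit. *)
Definition stab_sum M g : F :=
  \sum_(h : 'S_k * 'S_l) chr U h^-1%g * #|labellings_of M g h|%:R.

(** The fixed labelling b of the entries of M turns a permutation z into the
labelling b z^-1. *)
Lemma card_ind_fixed M (b : ones_label M) g (u : subg_of (Qstab M)) :
  #|[set z : 'S_m | ones_perm b u * z * g == z]%g| = #|labellings_of M g (sgval u)|.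
Proof.
pose lb (z : 'S_m) : {ffun 'I_m -> 'I_k * 'I_l} := [ffun a => b (z^-1%g a)].
have lb_inj : injective lb.
  move=> z z' e; apply: (@invg_inj [the finGroupType of 'S_m]); apply/permP=> a.
  by have /ffunP/(_ a) := e; rewrite !ffunE => /(@ones_lab_inj _ _ _ _ b).
rewrite -(card_imset _ lb_inj); apply: eq_card => be; rewrite inE.
have cmE z : commutes g (sgval u) (lb z) = (ones_perm b u * z * g == z)%g.
  have -> : (ones_perm b u * z * g == z)%g = (g * z^-1 * ones_perm b u == z^-1)%g.
    apply/eqP/eqP=> e.
      by rewrite -{1}e !invMg !mulgA mulgV mul1g mulgKV.
    have -> : ones_perm b u = (z * g^-1 * z^-1)%g.
      by apply: (mulgI (g * z^-1)%g); rewrite e !mulgA mulgKV mulgV mul1g.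
    by rewrite mulgKV mulgKV.
  apply/forallP/eqP=> [cm | e a].
    apply/permP=> a; apply: (@ones_lab_inj _ _ _ _ b).
    have /eqP := cm a; rewrite !ffunE => <-.
    by rewrite !permM [ones_perm b u _]permE ones_perm_funE.
  by rewrite !ffunE -[in X in _ == X]e !permM [ones_perm b u _]permE ones_perm_funE.
apply/imsetP/and3P => [[z + ->] | [/injectiveP injb /eqP im cm]].
  rewrite inE -cmE => cm; split=> //.
    by apply/injectiveP=> a a'; rewrite !ffunE => /(@ones_lab_inj _ _ _ _ b)/perm_inj.
  rewrite -(ones_labP b); apply/eqP/setP=> p; apply/imsetP/imsetP=> -[a _ ->].
    by exists (z^-1%g a); rewrite ?ffunE.
  by exists (z a); rewrite ?ffunE ?permK.
have /boolp.choice[y yE] (a : 'I_m) : exists c, b c = be a.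
  have : be a \in [set b a | a : 'I_m] by rewrite ones_labP -im imset_f.
  by case/imsetP=> c _ ->; exists c.
have y_inj : injective y by move=> a a' e; apply: injb; rewrite -!yE e.
have lbE : lb (perm y_inj)^-1%g = be.
  by apply/ffunP=> a; rewrite ffunE invgK permE yE.
by exists (perm y_inj)^-1%g; rewrite ?inE -?cmE lbE.
Qed.

Lemma chr_ind M (b : ones_label M) g :
  chr (ind_rep (ones_perm_morphism b) (res_rep (Qstab M) U)) g =
  #|Qstab M|%:R^-1 * stab_sum M g.
Proof.
rewrite [LHS](chr_btens charF0) card_subg_of; congr (_ * _).
transitivity (\sum_(h in Qstab M) chr U h^-1%g * #|labellings_of M g h|%:R).
  rewrite -[RHS]big_subg; apply: eq_bigr => u _; rewrite mulrC; congr (_ * _).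
  rewrite [X in lftr X]pmap_lin_comp lftr_pmap_lin -(card_ind_fixed b).
  by congr (_%:R); apply: eq_card => z; rewrite !inE.
rewrite big_mkcond; apply: eq_bigr => h _; case: ifP => // nh.
case: (set_0Vmem (labellings_of M g h)) => [-> | [be /labellings_Qstab]].
  by rewrite cards0 mulr0.
by rewrite nh.
Qed.

Lemma chr_conj (gT : finGroupType) (V : group_rep F gT) (x y : gT) :
  chr V (x ^ y)%g = chr V x.
Proof.
rewrite /chr conjgE !group_actM -comp_lfunA lftr_comp -comp_lfunA -group_actM.
by rewrite mulgV group_act1 comp_lfun1r.
Qed.

(** Moving M by y conjugates the elements h and moves the labellings. *)
Lemma stab_sum_orbit M y g : stab_sum (Qact k l m M y) g = stab_sum M g.
Proof.
rewrite /stab_sum (reindex_inj (conjg_inj y)); apply: eq_bigr => h _.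
rewrite -conjVg chr_conj; congr (_ * _%:R).
pose f (be : {ffun 'I_m -> 'I_k * 'I_l}) : {ffun 'I_m -> 'I_k * 'I_l} :=
  [ffun a => perm_cell y (be a)].
have f_inj : injective f.
  move=> be be' /ffunP e; apply/ffunP=> a.
  by have := e a; rewrite !ffunE => /perm_cell_inj.
rewrite -[in RHS](card_imset _ f_inj); apply: eq_card => be.
have fE be' : (f be' \in labellings_of (Qact k l m M y) g (h ^ y)%g) =
    (be' \in labellings_of M g h).
  rewrite !inE; congr [&& _, _ & _].
  - apply/injectiveP/injectiveP=> inj a a' e; apply: inj.
      by rewrite !ffunE e.
    by move: e; rewrite !ffunE => /perm_cell_inj.
  - have -> : [set f be' a | a : 'I_m] = [set perm_cell y p | p in [set be' a | a : 'I_m]].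
      by rewrite -imset_comp; apply: eq_imset => a; rewrite ffunE.
    rewrite [val _]/(perm_mat y (val M)) ones_perm_mat.
    apply/eqP/eqP=> [|-> //]; exact/imset_inj/perm_cell_inj.
  - apply: eq_forallb => a; rewrite !ffunE -!perm_cellM conjgE !mulgA mulgV mul1g.
    by rewrite perm_cellM (inj_eq (@perm_cell_inj _ _ y)).
apply/idP/imsetP=> [be_in | [be' + ->]]; last by rewrite fE.
have fK : f [ffun a => perm_cell y^-1%g (be a)] = be.
  apply/ffunP=> a; rewrite !ffunE -perm_cellM mulVg /perm_cell !perm1.
  by rewrite -surjective_pairing.
by exists [ffun a => perm_cell y^-1%g (be a)]; rewrite -?fE fK.
Qed.

Lemma sum_stab_sum (X : {set Qmat k l m}) g :
    is_transversal X [set orbit (Qact k l m) [set: 'S_k * 'S_l] M | M : Qmat k l m]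
      [set: Qmat k l m] ->
  (#|'S_k|%:R * #|'S_l|%:R)^-1 * \sum_M stab_sum M g =
  \sum_(M in X) #|Qstab M|%:R^-1 * stab_sum M g.
Proof.
set P := [set _ | _ in _] => trX; have /and3P[partP _ _] := trX.
have pbE M : pblock P M = orbit (Qact k l m) [set: 'S_k * 'S_l] M.
  by apply: def_pblock (partition_trivIset partP) _ (orbit_refl _ _ _); apply: imset_f.
have -> : \sum_M stab_sum M g = \sum_(M in [set: Qmat k l m]) stab_sum M g.
  by apply: eq_bigl => M; rewrite inE.
rewrite (set_partition_big P partP) /=.
rewrite -(pblock_transversal trX) big_imset /=; last exact: pblock_inj trX.
rewrite mulr_sumr; apply: eq_bigr => M _; rewrite pbE.
rewrite (eq_bigr (fun=> stab_sum M g)); last first.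
  by move=> _ /orbitP[y _ <-]; apply: stab_sum_orbit.
rewrite sumr_const -[X in _ * X = _]mulr_natl mulrA; congr (_ * _).
have /(congr1 (fun i => i%:R : F)) := card_orbit_stab (Qact k l m) [group of [set: 'S_k * 'S_l]] M.
rewrite setTI natrM cardsT card_prod natrM => <-.
have cQ : #|Qstab M|%:R != 0 :> F by rewrite ((pcharf0P F).1 charF0) -lt0n cardG_gt0.
have cO : #|orbit (Qact k l m) [set: 'S_k * 'S_l] M|%:R != 0 :> F.
  rewrite ((pcharf0P F).1 charF0) -lt0n; apply/card_gt0P; exists M; exact: orbit_refl.
by rewrite invfM mulrAC mulVf // mul1r.
Qed.
End MatrixOrbits.

(** * The multiplicity formula *)

Lemma chr_outer (F : fieldType) (gT hT : finGroupType) (U : group_rep F gT)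
    (V : group_rep F hT) (x : gT * hT) :
  chr (outer_rep U V) x = chr U x.1 * chr V x.2.
Proof. exact: lftr_tens. Qed.

(** Both sides are scalar products over S_m with the character of S, and the
class functions agree by the count of labellings. *)
Lemma mult_tens_cell_simple (F : closedFieldType) (charF0 : [pchar F] =i pred0)
    (n k l m : nat) (rho : lpart n k) (sigma : lpart n l) (tau : lpart n m)
    (S1 : group_rep F 'S_k) (S2 : group_rep F 'S_l) (S : group_rep F 'S_m)
    (X : {set Qmat k l m})
    (transX : is_transversal X
       [set orbit (Qact k l m) [set: 'S_k * 'S_l] M | M : Qmat k l m]
       [set: Qmat k l m])
    (b : forall M : Qmat k l m, ones_label M) :
  mult (tens_rep (btens (cell_bimod rho F) S1) (btens (cell_bimod sigma F) S2))
       (btens (cell_bimod tau F) S)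
  = (\sum_(M in X)
       mult (ind_rep (ones_perm_morphism (b M))
               (res_rep (Qstab M) (outer_rep S1 S2))) S)%N.
Proof.
have [irrS | nirrS] := boolp.EM (irreducible_rep S); last first.
  rewrite (mult_cell_simple0 charF0) // big1 // => M _.
  exact: mult_not_irreducible.
have natF_inj : injective (fun i : nat => i%:R : F).
  move=> i j /eqP; wlog le : i j / (i <= j)%N => [h | e].
    by case: (leqP i j) => [/h // | /ltnW/h ji e]; rewrite ji // eq_sym.
  move: e; rewrite eq_sym -subr_eq0 -natrB // ((pcharf0P F).1 charF0) subn_eq0 => ji.
  by apply/eqP; rewrite eqn_leq le.
apply: natF_inj; rewrite natr_sum (mult_cell_simple charF0) //.
under [RHS]eq_bigr do rewrite (mult_group charF0) //.
rewrite -mulr_sumr exchange_big; congr (_ * _); apply: eq_bigr => g _ /=.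
rewrite -mulr_sumr; congr (_ * _); rewrite (lftr_tens_cells charF0).
under [RHS]eq_bigr do rewrite (chr_ind charF0).
rewrite -(sum_stab_sum charF0 _ _ transX); congr (_ * _).
rewrite exchange_big; apply: eq_bigr => h _ /=.
rewrite -mulr_sumr chr_outer; congr (_ * _).
by rewrite lftr_cells_count card_fixed_cells card_surj_labellings natr_sum.
Qed.

Theorem corollary8 (F : closedFieldType) (charF0 : [pchar F] =i pred0)
    (n k l m : nat)
    (rho : lpart n k) (sigma : lpart n l) (tau : lpart n m)
    (la : intpart k) (mu : intpart l) (nu : intpart m)
    (X : {set Qmat k l m})
    (transX : is_transversal X
       [set orbit (Qact k l m) [set: 'S_k * 'S_l] M | M : Qmat k l m]
       [set: Qmat k l m])
    (b : forall M : Qmat k l m, ones_label M) :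
  mult (tens_rep (cell_simple F rho la) (cell_simple F sigma mu))
       (cell_simple F tau nu)
  = (\sum_(M in X)
       mult (ind_rep (ones_perm_morphism (b M))
               (res_rep (Qstab M) (outer_rep (specht F la) (specht F mu))))
            (specht F nu))%N.
Proof. exact: mult_tens_cell_simple. Qed.
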